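(* Let $G$ be a coexact compact quantum group, and let $(A,\alpha)$, $(B,\beta)$ be $G$-C*-algebras. Assume that $\phi:(A,\alpha)\to(B,\beta)$ is a $G$-equivariantly sequentially split $*$-homomorphism. Then the induced $*$-homomorphism $\phi:A^\alpha\to B^\beta$ is sequentially split.
   Context: **Quantum groups.** $\otimes$ denotes the minimal tensor product of C*-algebras, $[X]$ the closed linear span. Compact quantum groups are taken in the reduced setting of Kustermans–Vaes: $G$ is given by the unital C*-algebra $C^{\mathsf r}(G)\subset\mathbb L(L^2(G))$ (reduced function algebra, acting on the GNS space of the Haar state) with comultiplication $\Delta:C^{\mathsf r}(G)\to C^{\mathsf r}(G)\otimes C^{\mathsf r}(G)$; all quantum groups are second countable ($L^2(G)$ separable). $G$ is coexact if its dual is exact (taking reduced crossed products by the dual is an exact functor), equivalently if $C^{\mathsf r}(G)$ is an exact C*-algebra. **Actions.** A $G$-C*-algebra $(A,\alpha)$ is a C*-algebra $A$ with an injective nondegenerate $*$-homomorphism $\alpha:A\to C^{\mathsf r}(G)\otimes A$ with $(\Delta\otimes\mathrm{id})\alpha=(\mathrm{id}\otimes\alpha)\alpha$ and $[\alpha(A)(C^{\mathsf r}(G)\otimes 1)]=C^{\mathsf r}(G)\otimes A$. A $*$-homomorphism $\phi:(A,\alpha)\to(B,\beta)$ is equivariant if $\beta\phi=(\mathrm{id}\otimes\phi)\alpha$. The fixed point algebra is $A^\alpha=\{a\in A\mid \alpha(a)=1\otimes a\}$. **Sequence algebras.** $A_\infty=\ell^\infty(A)/c_0(A)$, containing $A$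 as constant sequences. A $*$-homomorphism $\phi:A\to B$ is sequentially split if there is a $*$-homomorphism $\psi:B\to A_\infty$ with $\psi(\phi(a))=a$ for all $a\in A$. Applying $\alpha$ componentwise gives $\alpha_\infty:A_\infty\to (C^{\mathsf r}(G)\otimes A)_\infty$, and $C^{\mathsf r}(G)\otimes A_\infty\subset (C^{\mathsf r}(G)\otimes A)_\infty$ canonically by exactness of $C^{\mathsf r}(G)$. A $*$-homomorphism $\psi:(B,\beta)\to A_\infty$ is $G$-equivariant if $\alpha_\infty\psi=(\mathrm{id}\otimes\psi)\beta$ as maps $B\to (C^{\mathsf r}(G)\otimes A)_\infty$. An equivariant $\phi:(A,\alpha)\to(B,\beta)$ is $G$-equivariantly sequentially split if there is a $G$-equivariant $\psi:B\to A_\infty$ with $\psi(\phi(a))=a$ for all $a\in A$. *)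

(* Defs.v *)
From HB Require Import structures.
From mathcomp Require Import all_boot all_order all_algebra.
From mathcomp Require Import complex.
From mathcomp Require Import boolp classical_sets functions cardinality reals.
From mathcomp Require Import topology tvs normedtype sequences.
From mathcomp Require Import generic_quotient ring_quotient ring lra.
Set Implicit Arguments.
Unset Strict Implicit.
Unset Printing Implicit Defensive.
Import Order.TTheory GRing.Theory Num.Theory.
Import numFieldNormedType.Exports.
Local Open Scope classical_set_scope.
Local Open Scope complex_scope.
Local Open Scope ring_scope.
Local Open Scope quotient_scope.

(* C*-algebras need not be unital, so the product is not the one of a MathComp
   ring structure. *)
HB.mixin Record CompleteNormedModule_isCStarAlgebra (R : realType) A
    & CompleteNormedModule R[i] A := {
  amul : A -> A -> A;
  adj : A -> A;
  amulA : associative amul;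
  amulDl : left_distributive amul +%R;
  amulDr : right_distributive amul +%R;
  amulZl : forall (c : R[i]) x y, amul (c *: x) y = c *: amul x y;
  amulZr : forall (c : R[i]) x y, amul x (c *: y) = c *: amul x y;
  adjK : involutive adj;
  adjD : {morph adj : x y / x + y};
  adjZ : forall (c : R[i]) x, adj (c *: x) = c^* *: adj x;
  adjM : forall x y, adj (amul x y) = amul (adj y) (adj x);
  norm_amul : forall x y, `|amul x y| <= `|x| * `|y| :> R[i];
  norm_adjM : forall x, `|amul (adj x) x| = `|x| ^+ 2 :> R[i]
}.

#[short(type="cstarAlgType")]
HB.structure Definition CStarAlgebra (R : realType) :=
  {A of CompleteNormedModule_isCStarAlgebra R A & CompleteNormedModule R[i] A}.

Notation "x ** y" := (amul x y) (at level 40, left associativity) : ring_scope.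

HB.mixin Record CompleteNormedModule_isHilbert (R : realType) H
    & CompleteNormedModule R[i] H := {
  inner : {dot H for Num.conj};
  normr_inner : forall x : H, `|x| ^+ 2 = inner x x
}.

#[short(type="hilbertType")]
HB.structure Definition Hilbert (R : realType) :=
  {H of CompleteNormedModule_isHilbert R H & CompleteNormedModule R[i] H}.

Section Span.
Context {R : realType} {V : normedModType R[i]}.

(* the closed linear span of S *)
Definition cspan (S : set V) : set V :=
  closure [set x | exists n (c : 'I_n -> R[i]) (v : 'I_n -> V),
    (forall i, S (v i)) /\ x = \sum_(i < n) c i *: v i].

End Span.

Definition star_hom (R : realType) (A B : cstarAlgType R)
    (f : {linear A -> B}) : Prop :=
  (forall x y, f (x ** y) = f x ** f y) /\ (forall x, f (adj x) = adj (f x)).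

(* An injective *-representation of A on H is isometric; act_norm says that the
   norm of x is the operator norm of its action. *)
Record faithful_rep (R : realType) (A : cstarAlgType R) (H : hilbertType R) := {
  act :> A -> {linear H -> H};
  actD : forall x y h, act (x + y) h = act x h + act y h;
  actZ : forall (c : R[i]) x h, act (c *: x) h = c *: act x h;
  actM : forall x y h, act (x ** y) h = act x (act y h);
  act_adj : forall x h k, inner (act (adj x) h) k = inner h (act x k);
  act_norm : forall x (c : R[i]), 0 <= c ->
    `|x| <= c <-> (forall h, `|act x h| <= c * `|h|)
}.

(* A C*-algebra together with a faithful representation on a Hilbert space; every
   C*-algebra has one by Gelfand-Naimark. The representation only serves to form
   spatial tensor products. *)
Record concreteCstar (R : realType) := ConcreteCstar {
  cc_alg :> cstarAlgType R;
  cc_space : hilbertType R;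
  cc_rep : faithful_rep cc_alg cc_space
}.

(* The norm of a normed R[i]-module has its values in R[i]. *)
Definition rnorm (R : realType) (V : normedModType R[i]) (x : V) : R :=
  complex.Re `|x|.

Section RNorm.
Context {R : realType} {V : normedModType R[i]}.
Implicit Types (x y : V) (u : nat -> V).

Lemma rnormE x : `|x| = (rnorm x)%:C.
Proof. by rewrite RRe_real// realE normr_ge0. Qed.

Lemma rnorm_ge0 x : 0 <= rnorm x.
Proof. by rewrite -lecR -rnormE normr_ge0. Qed.

Lemma rnorm0 : rnorm (0 : V) = 0.
Proof. by apply: complexI; rewrite -rnormE normr0. Qed.

Lemma rnorm0_eq0 x : rnorm x = 0 -> x = 0.
Proof. by move=> x0; apply/eqP; rewrite -normr_eq0 rnormE x0. Qed.

Lemma rnormN x : rnorm (- x) = rnorm x.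
Proof. by apply: complexI; rewrite -!rnormE normrN. Qed.

Lemma rnormB x y : rnorm (x - y) = rnorm (y - x).
Proof. by rewrite -rnormN opprB. Qed.

Lemma rnormD x y : rnorm (x + y) <= rnorm x + rnorm y.
Proof. by rewrite -lecR rmorphD/= -!rnormE ler_normD. Qed.

Lemma rnormZ (c : R[i]) x : rnorm (c *: x) = complex.Re `|c| * rnorm x.
Proof.
by apply: complexI; rewrite -!rnormE normrZ rnormE rmorphM/=.
Qed.

Lemma rnorm_sum n (f : nat -> V) :
  rnorm (\sum_(0 <= i < n) f i) <= \sum_(0 <= i < n) rnorm (f i).
Proof.
elim: n => [|n IH]; first by rewrite !big_geq// rnorm0.
by rewrite !big_nat_recr//= (le_trans (rnormD _ _))// lerD2r.
Qed.

Lemma rnorm_le x (r : R) : (rnorm x <= r) = (`|x| <= r%:C).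
Proof. by rewrite rnormE lecR. Qed.

Lemma rnorm_lt x (r : R) : (rnorm x < r) = (`|x| < r%:C).
Proof. by rewrite rnormE ltcR. Qed.

Lemma Re_gt0 (e : R[i]) : 0 < e -> 0 < complex.Re e /\ e = (complex.Re e)%:C.
Proof.
move=> e0; have eE : e = (complex.Re e)%:C.
  by rewrite RRe_real// realE (ltW e0).
by split => //; rewrite -ltcR -eE.
Qed.

Lemma cvg_rnormP u x :
  u n @[n --> \oo] --> x <->
  forall e : R, 0 < e -> \forall n \near \oo, rnorm (x - u n) < e.
Proof.
split=> [/cvgrPdist_lt ux e e0|ux].
  have := ux e%:C; rewrite ltcR => /(_ e0).
  by apply: filterS => n; rewrite rnorm_lt.
apply/cvgrPdist_lt => e /Re_gt0[e0 eE].
by move: (ux _ e0); apply: filterS => n; rewrite rnorm_lt -eE.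
Qed.

End RNorm.

Lemma cauchy_seq_cvg (R : realType) (V : completeNormedModType R[i])
    (u : nat -> V) :
  (forall e : R, 0 < e -> exists N, forall n, (N <= n)%N ->
     rnorm (u N - u n) < e) ->
  cvg (u n @[n --> \oo]).
Proof.
move=> cu; apply: cauchy_cvg; apply: cauchy_exP => e /Re_gt0[e0 eE].
have [N uN] := cu _ e0; exists (u N); exists N => // n /= Nn.
by rewrite -ball_normE/= eE -rnorm_lt; exact: uN.
Qed.

Lemma complete_fast_cauchy (R : realType) (V : normedModType R[i]) :
  (forall u : nat -> V,
     (forall n, rnorm (u n.+1 - u n) < 2^-1 ^+ n) -> cvg (u n @[n --> \oo])) ->
  forall F : set_system V, ProperFilter F -> cauchy F -> cvg F.
Proof.
move=> cV F FF /cauchyP cF.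
have h0 n : 0 < ((2^-1 ^+ n / 2 / 2 : R)%:C).
  by rewrite ltcR !divr_gt0// exprn_gt0// invr_gt0.
pose x n := projT1 (cid (cF _ (h0 n))).
have Fx n : F (ball (x n) (2^-1 ^+ n / 2 / 2 : R)%:C).
  exact: projT2 (cid (cF _ (h0 n))).
have ux n : rnorm (x n.+1 - x n) < 2^-1 ^+ n.
  have [y []] : (ball (x n) (2^-1 ^+ n / 2 / 2 : R)%:C `&`
      ball (x n.+1) (2^-1 ^+ n.+1 / 2 / 2 : R)%:C) !=set0.
    by apply: (@filter_ex _ F); apply: filterI; exact: Fx.
  rewrite -!ball_normE/= -!rnorm_lt => xy xy1.
  rewrite -[x n.+1](subrK y) -addrA (le_lt_trans (rnormD _ _))//.
  rewrite [rnorm (y - _)]rnormB.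
  have p0 : (0 : R) < 2^-1 ^+ n by rewrite exprn_gt0// invr_gt0.
  by move: xy xy1 p0; rewrite exprS; lra.
have /cvg_ex[l xl] := cV _ ux.
apply/cvg_ex; exists l; apply/cvgrPdist_lt => e /Re_gt0[e0 eE].
rewrite eE.
have e20 : 0 < complex.Re e / 2 by rewrite divr_gt0.
have /cvg_rnormP/(_ _ e20) xle := xl.
have ge : \forall n \near \oo, (2^-1 ^+ n : R) < complex.Re e / 2.
  have /cvgrPdist_lt/(_ _ e20) : (fun n => (2^-1 : R) ^+ n) n @[n --> \oo] --> (0 : R).
    apply: cvg_expr; rewrite ger0_norm ?invr_ge0// invf_lt1// ltr1n//.
  apply: filterS => n; rewrite sub0r normrN ger0_norm//.
  by rewrite exprn_ge0// invr_ge0.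
have [n [nl ng]] : exists n, rnorm (l - x n) < complex.Re e / 2 /\
    2^-1 ^+ n < complex.Re e / 2.
  by apply: (@filter_ex _ \oo); apply: filterI.
apply: filterS (Fx n) => y; rewrite -ball_normE/= -!rnorm_lt => xy.
rewrite -[l](subrK (x n)) -addrA (le_lt_trans (rnormD _ _))//.
rewrite [ltRHS]splitr ltrD// (lt_trans xy)// (le_lt_trans _ ng)//.
have p0 : (0 : R) < 2^-1 ^+ n by rewrite exprn_gt0// invr_gt0.
by lra.
Unshelve. all: by end_near. Qed.

Section CStarTheory.
Context {R : realType} {A : cstarAlgType R}.
Implicit Types (x y : A).

Lemma amul0l x : 0 ** x = 0.
Proof. by rewrite -[X in X ** _](scale0r (0 : A)) amulZl scale0r. Qed.

Lemma amul0r x : x ** 0 = 0.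
Proof. by rewrite -[X in _ ** X](scale0r (0 : A)) amulZr scale0r. Qed.

Lemma amulNl x y : (- x) ** y = - (x ** y).
Proof. by rewrite -[- x]scaleN1r amulZl scaleN1r. Qed.

Lemma amulNr x y : x ** (- y) = - (x ** y).
Proof. by rewrite -[- y]scaleN1r amulZr scaleN1r. Qed.

Lemma adj0 : adj (0 : A) = 0.
Proof. by rewrite -[X in adj X](scale0r (0 : A)) adjZ rmorph0 scale0r. Qed.

Lemma adjN x : adj (- x) = - adj x.
Proof. by rewrite -[- x]scaleN1r adjZ rmorphN rmorph1 scaleN1r. Qed.

Lemma rnorm_amul x y : rnorm (x ** y) <= rnorm x * rnorm y.
Proof. by rewrite -lecR rmorphM/= -!rnormE norm_amul. Qed.

Lemma rnorm_adjM x : rnorm (adj x ** x) = rnorm x ^+ 2.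
Proof. by apply: complexI; rewrite rmorphXn/= -!rnormE norm_adjM. Qed.

Lemma rnorm_adj x : rnorm (adj x) = rnorm x.
Proof.
suff le y : rnorm y <= rnorm (adj y).
  by apply/eqP; rewrite eq_le le -{2}[x]adjK le.
have [->|y0] := eqVneq (rnorm y) 0; first exact: rnorm_ge0.
have yp : 0 < rnorm y by rewrite lt_neqAle eq_sym y0 rnorm_ge0.
by rewrite -(ler_pM2r yp) -expr2 -rnorm_adjM rnorm_amul.
Qed.

Lemma half_double x : 2 *: (2^-1 *: x) = x :> A.
Proof. by rewrite scalerA mulfV ?scale1r// pnatr_eq0. Qed.

Lemma rnorm_half x : rnorm (2^-1 *: x) = rnorm x / 2.
Proof.
rewrite rnormZ mulrC; congr (_ * _); apply: complexI.
by rewrite RRe_real ?realE ?normr_ge0// fmorphV rmorph_nat ger0_norm ?invr_ge0.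
Qed.

Lemma amulBB x y : x ** x - y ** y = x ** (x - y) + (x - y) ** y.
Proof.
by rewrite amulDr amulDl amulNr amulNl addrA subrK.
Qed.

(* 1 - y has a self-adjoint square root 1 - c when y = y^* and |y| < 1 *)
Lemma sqrt_one_sub y : adj y = y -> rnorm y < 1 ->
  exists2 c : A, adj c = c & 2 *: c - c ** c = y.
Proof.
move=> ya; set q := rnorm y => q1; have q0 : 0 <= q by exact: rnorm_ge0.
pose f (c : A) : A := 2^-1 *: (y + c ** c).
pose c n : A := iter n f 0.
have cS n : c n.+1 = 2^-1 *: (y + c n ** c n) by [].
have c_le n : rnorm (c n) <= q.
  elim: n => [|n IH]; first by rewrite /= rnorm0.
  rewrite /= rnorm_half ler_pdivrMr// mulr_natr mulr2n.
  rewrite (le_trans (rnormD _ _))// lerD2l (le_trans (rnorm_amul _ _))//.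
  rewrite (le_trans (ler_pM _ _ IH IH)) ?rnorm_ge0//.
  by rewrite -[leRHS]mulr1 ler_wpM2l// ltW.
have dc n : rnorm (c n - c n.+1) <= q ^+ n.
  elim: n => [|n IH].
    rewrite expr0 rnormB (le_trans (rnormD _ _))// rnormN rnorm0 addr0.
    by rewrite (le_trans (c_le _))// ltW.
  have -> : c n.+1 - c n.+2 = 2^-1 *: (c n ** c n - c n.+1 ** c n.+1).
    by rewrite [c n.+2]cS [in LHS]cS -scalerBr opprD addrACA subrr add0r.
  rewrite rnorm_half amulBB.
  rewrite ler_pdivrMr// (le_trans (rnormD _ _))// mulr_natr mulr2n exprS.
  rewrite lerD// (le_trans (rnorm_amul _ _))//; last rewrite mulrC;
    by rewrite ler_pM ?rnorm_ge0 ?c_le.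
have cc n k : rnorm (c n - c (n + k)%N) * (1 - q) <= q ^+ n * (1 - q ^+ k).
  elim: k => [|k IH]; first by rewrite addn0 !subrr rnorm0 mul0r mulr0.
  have -> : c n - c (n + k.+1)%N =
      (c n - c (n + k)%N) + (c (n + k)%N - c (n + k).+1) :> A.
    by rewrite addnS addrA subrK.
  rewrite (le_trans (ler_wpM2r _ (rnormD _ _))) ?subr_ge0 ?(ltW q1)//.
  have -> : q ^+ n * (1 - q ^+ k.+1) =
      q ^+ n * (1 - q ^+ k) + q ^+ (n + k) * (1 - q).
    by rewrite exprS exprD; ring.
  by rewrite mulrDl lerD// ler_wpM2r ?subr_ge0 ?(ltW q1).
have q1' : 0 < 1 - q by rewrite subr_gt0.
have cvgq : (q ^+ n @[n --> \oo] --> (0 : R)).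
  by apply: cvg_expr; rewrite ger0_norm.
have cc' N n : (N <= n)%N -> rnorm (c N - c n) <= q ^+ N / (1 - q).
  move=> Nn; rewrite ler_pdivlMr// -(subnKC Nn) (le_trans (cc _ _))//.
  by rewrite ler_piMr ?exprn_ge0// lerBlDr lerDl exprn_ge0.
have /cvg_ex[l /cvg_rnormP cl] : cvg (c n @[n --> \oo]).
  apply: cauchy_seq_cvg => e e0.
  have /cvgrPdist_lt/(_ _ (mulr_gt0 e0 q1'))[N _ NP] := cvgq.
  exists N => n Nn; rewrite (le_lt_trans (cc' _ _ Nn))// ltr_pdivrMr//.
  by have := NP N (leqnn _); rewrite /= sub0r normrN ger0_norm// exprn_ge0.
have small (x : A) (M : R) : (forall e, 0 < e -> e < 1 -> rnorm x <= M * e) -> x = 0.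
  move=> xM; apply: rnorm0_eq0; apply/eqP; rewrite eq_le rnorm_ge0 andbT.
  apply/ler_addgt0Pl => e e0; rewrite addr0.
  have M0 : 0 < `|M| + 1 by rewrite ltr_wpDl.
  have e'0 : 0 < Num.min (2^-1) (e / (`|M| + 1)).
    by rewrite lt_min divr_gt0// andbT invr_gt0.
  apply: le_trans (xM _ e'0 _) _.
    by rewrite gt_min invf_lt1// ltr1n.
  apply: (@le_trans _ _ ((`|M| + 1) * Num.min (2^-1) (e / (`|M| + 1)))).
    by rewrite ler_pM2r// (le_trans (ler_norm _))// lerDl.
  by rewrite -ler_pdivlMl// mulrC ge_min lexx orbT.
have ca n : adj (c n) = c n.
  by elim: n => [|n IH]; rewrite ?adj0//= adjZ adjD adjM IH ya fmorphV rmorph_nat.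
exists l.
  apply/subr0_eq/(small _ 2) => e e0 _.
  have [n ln] := filter_ex (cl _ e0).
  have -> : adj l - l = adj (l - c n) + (c n - l).
    by rewrite adjD adjN ca addrA subrK.
  rewrite (le_trans (rnormD _ _))// rnorm_adj [rnorm (c n - l)]rnormB.
  by rewrite mulrC mulr_natr mulr2n lerD// ltW.
apply/subr0_eq/(small _ (2 + (q + 1 + q))) => e e0 e1.
have [n [ln ln1]] : exists n, rnorm (l - c n) < e /\ rnorm (l - c n.+1) < e.
  have [N _ NP] := cl _ e0; exists N; split; apply: NP => //=.
have lq : rnorm l <= q + 1.
  rewrite -[l](subrK (c n)) addrC (le_trans (rnormD _ _))// lerD//.
  by rewrite (le_trans (ltW ln))// ltW.
have yE : y = 2 *: c n.+1 - c n ** c n.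
  by rewrite /= -/(c n) half_double addrK.
have -> : 2 *: l - l ** l - y = 2 *: (l - c n.+1) - (l ** l - c n ** c n).
  rewrite [X in _ - X = _]yE scalerBr !opprB addrAC [RHS]addrA.
  by rewrite -!addrA; congr (_ + _); rewrite addrCA; congr (_ + _); rewrite addrC.
rewrite (le_trans (rnormD _ _))// rnormN mulrDl lerD//.
  rewrite -[X in X <= _]/(rnorm (2 *: _)) scaler_nat mulr2n.
  by rewrite (le_trans (rnormD _ _))// mulrC mulr_natr mulr2n lerD// ltW.
rewrite amulBB (le_trans (rnormD _ _))// mulrDl.
rewrite lerD// (le_trans (rnorm_amul _ _))//.
  by rewrite ler_pM ?rnorm_ge0// ltW.
by rewrite mulrC ler_pM ?rnorm_ge0// ltW.
Qed.

End CStarTheory.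

Section Contractive.
Context {R : realType} {A B : cstarAlgType R} {H : hilbertType R}.
Variables (p : faithful_rep B H) (f : {linear A -> B}).
Hypothesis fs : star_hom f.

Lemma inner_ge0 (h : H) : 0 <= inner h h.
Proof. by rewrite -normr_inner exprn_ge0. Qed.

Lemma star_hom_norm x : `|f x| <= `|x|.
Proof.
have [fM fA] := fs.
apply/(act_norm p) => // h.
rewrite -(@ler_pXn2r _ 2%N)// ?nnegrE ?mulr_ge0//.
rewrite exprMn !normr_inner.
suff le (r : R) : rnorm x ^+ 2 < r ->
    inner (p (f x) h) (p (f x) h) <= r%:C * inner h h.
  have [i0|i0] := eqVneq (inner h h) 0.
    have := le (rnorm x ^+ 2 + 1); rewrite ltrDl ltr01 => /(_ isT).
    by rewrite i0 !mulr0.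
  have ip : 0 < inner h h by rewrite lt_neqAle eq_sym i0 inner_ge0.
  rewrite -ler_pdivrMr// rnormE -rmorphXn/=.
  have /Num.Theory.ger0_real/complex_realP[k kE] :
      0 <= inner (p (f x) h) (p (f x) h) / inner h h.
    by rewrite divr_ge0 ?inner_ge0.
  rewrite kE lecR; apply/ler_addgt0Pl => e e0; rewrite addrC.
  rewrite -lecR -kE ler_pdivrMr//; apply: le.
  by rewrite ltrDl.
move=> xr; have r0 : 0 < r by rewrite (le_lt_trans _ xr)// exprn_ge0// rnorm_ge0.
have rC0 : r%:C != 0 :> R[i] by rewrite gt_eqF// ltcR.
pose y : A := (r%:C)^-1 *: (adj x ** x).
have ya : adj y = y.
  by rewrite /y adjZ adjM adjK fmorphV/= conj_Creal// realE ltW// ltcR.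
have y1 : rnorm y < 1.
  have -> : rnorm y = rnorm x ^+ 2 / r.
    apply: complexI; rewrite rmorphM fmorphV/= -rnorm_adjM -!rnormE /y normrZ.
    by rewrite normfV gtr0_norm ?ltcR// mulrC.
  by rewrite ltr_pdivrMr// mul1r.
have [c ca cy] := sqrt_one_sub ya y1.
have := inner_ge0 (h - p (f c) h).
have -> : inner (h - p (f c) h) (h - p (f c) h) =
    inner h h - inner h (p (f y) h).
  have pc k l : inner (p (f c) k) l = inner k (p (f c) l).
    by rewrite -act_adj -fA ca.
  have -> : p (f y) h = 2 *: p (f c) h - p (f c) (p (f c) h).
    rewrite -cy linearB/= linearZ_LR/= fM actD actZ; congr (_ + _).
    by rewrite -scaleN1r actZ actM scaleN1r.
  rewrite linearBl !linearBr/= -!pc scaler_nat mulr2n linearDr/= -!pc.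
  by ring.
rewrite subr_ge0 /y linearZ/= actZ fM fA actM.
have rJ : Num.conj (r%:C)^-1 = (r%:C)^-1.
  by rewrite fmorphV/= conj_Creal// realE ltW// ltcR.
rewrite linearZr_LR/= rJ.
have -> : inner h (p (adj (f x)) (p (f x) h)) = inner (p (f x) h) (p (f x) h).
  by rewrite -{1}[f x]adjK -act_adj !adjK.
by rewrite ler_pdivrMl// ltcR.
Qed.

End Contractive.

Section SequenceSpaces.
Context {R : realType} (A : cstarAlgType R).

Definition bounded_seq : {pred nat -> A} :=
  fun u => `[< exists M : R, forall n, rnorm (u n) <= M >].

Lemma bounded_seqP u :
  reflect (exists M : R, forall n, rnorm (u n) <= M) (u \in bounded_seq).
Proof. exact: asboolP. Qed.

Lemma bounded_seq_submod_closed : submod_closed bounded_seq.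
Proof.
split=> [|c u v /bounded_seqP[M uM] /bounded_seqP[N vN]]; apply/bounded_seqP.
  by exists 0 => n; rewrite rnorm0.
exists (complex.Re `|c| * M + N) => n; rewrite (le_trans (rnormD _ _))//.
rewrite lerD// rnormZ ler_wpM2l// -lecR RRe_real ?realE ?normr_ge0//.
Qed.

HB.instance Definition _ := GRing.isSubmodClosed.Build R[i] (nat -> A)
  bounded_seq bounded_seq_submod_closed.

Record linfty := Linfty {
  linfty_seq :> nat -> A;
  linfty_bounded : linfty_seq \in bounded_seq
}.
HB.instance Definition _ := [isSub for linfty_seq].
HB.instance Definition _ := [Choice of linfty by <:].
HB.instance Definition _ := [SubChoice_isSubLmodule of linfty by <:].

Definition c0 : {pred linfty} := fun u => `[< u n @[n --> \oo] --> (0 : A) >].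

Lemma c0P (u : linfty) : reflect (u n @[n --> \oo] --> (0 : A)) (u \in c0).
Proof. exact: asboolP. Qed.

Lemma c0_zmod_closed : zmod_closed c0.
Proof.
split=> [|u v /c0P u0 /c0P v0]; apply/c0P; first exact: cvg_cst.
by rewrite -[X in _ --> X](subr0 (0 : A)); exact: cvgB.
Qed.
HB.instance Definition _ := GRing.isZmodClosed.Build linfty c0 c0_zmod_closed.

Definition seqalg := Quotient.quot (c0 : zmodClosed linfty).
HB.instance Definition _ := GRing.Zmodule.on seqalg.

End SequenceSpaces.

Section SequenceAlgebra.
Context {R : realType} {A : cstarAlgType R}.
Implicit Types (u v w : linfty A) (x y z : seqalg A).

Definition cls u : seqalg A := \pi_(seqalg A) u.
Definition rep x : linfty A := repr x.

Lemma repK x : cls (rep x) = x. Proof. exact: reprK. Qed.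

Lemma clsP u v : cls u = cls v <->
  (forall e : R, 0 < e -> \forall n \near \oo, rnorm (u n - v n) < e).
Proof.
have -> : (cls u = cls v) <-> (u - v \in @c0 R A).
  rewrite (Quotient.idealrBE (@c0 R A : zmodClosed _)).
  by split=> [/eqP//|/eqP].
split=> [/c0P/cvg_rnormP uv e e0|uv].
  by have := uv e e0; apply: filterS => n; rewrite sub0r rnormN.
apply/c0P/cvg_rnormP => e e0.
by have := uv e e0; apply: filterS => n; rewrite sub0r rnormN.
Qed.

Lemma rep_cls u (e : R) : 0 < e ->
  \forall n \near \oo, rnorm (rep (cls u) n - u n) < e.
Proof. by move: e; apply/clsP; rewrite repK. Qed.

Lemma clsD u v : cls (u + v) = cls u + cls v.
Proof. by rewrite /cls !piE. Qed.

Lemma clsN u : cls (- u) = - cls u.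
Proof. by rewrite /cls !piE. Qed.

Lemma linftyP u : exists M : R, 0 < M /\ forall n, rnorm (u n) <= M.
Proof.
have /bounded_seqP[M uM] := linfty_bounded u; exists (`|M| + 1).
by split=> [|n]; rewrite ?ltr_wpDl// (le_trans (uM n))// ler_wpDr// ler_norm.
Qed.

Lemma bounded_mul u v : (fun n => u n ** v n) \in @bounded_seq R A.
Proof.
have [M [M0 uM]] := linftyP u; have [N [N0 vN]] := linftyP v.
apply/bounded_seqP; exists (M * N) => n.
by rewrite (le_trans (rnorm_amul _ _))// ler_pM ?rnorm_ge0.
Qed.
Definition linfty_mul u v := Linfty (bounded_mul u v).

Lemma bounded_adj u : (fun n => adj (u n)) \in @bounded_seq R A.
Proof.
have [M [M0 uM]] := linftyP u.
by apply/bounded_seqP; exists M => n; rewrite rnorm_adj.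
Qed.
Definition linfty_adj u := Linfty (bounded_adj u).

Definition seq_scale (c : R[i]) x := cls (c *: rep x).
Definition seq_mul x y := cls (linfty_mul (rep x) (rep y)).
Definition seq_adj x := cls (linfty_adj (rep x)).

Lemma linftyDE u v n : (u + v) n = u n + v n. Proof. by []. Qed.
Lemma linftyZE (c : R[i]) u n : (c *: u) n = c *: u n. Proof. by []. Qed.

Lemma clsZ c u : cls (c *: u) = seq_scale c (cls u).
Proof.
apply/clsP => e e0.
have c0 : 0 < complex.Re `|c| + 1.
  by rewrite ltr_wpDl// -lecR RRe_real ?realE ?normr_ge0.
have := rep_cls u (divr_gt0 e0 c0); apply: filterS => n un.
rewrite !linftyZE -scalerBr rnormZ rnormB.
rewrite ltr_pdivlMr// mulrC in un; apply: le_lt_trans un.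
by rewrite ler_wpM2r ?rnorm_ge0// lerDl.
Qed.

Lemma clsM u v : cls (linfty_mul u v) = seq_mul (cls u) (cls v).
Proof.
apply/clsP => e e0.
have [M [M0 uM]] := linftyP u; have [N [N0 vN]] := linftyP (rep (cls v)).
have e1 : 0 < e / 2 / M by rewrite !divr_gt0.
have e2 : 0 < e / 2 / N by rewrite !divr_gt0.
have := rep_cls u e2; have := rep_cls v e1; apply: filterS2 => n vn un.
rewrite /=.
have -> : u n ** v n - rep (cls u) n ** rep (cls v) n =
    u n ** (v n - rep (cls v) n) + (u n - rep (cls u) n) ** rep (cls v) n.
  by rewrite amulDr amulDl amulNr amulNl addrA subrK.
rewrite (le_lt_trans (rnormD _ _))// [ltRHS]splitr ltrD//.
  rewrite (le_lt_trans (rnorm_amul _ _))// [rnorm (v n - _)]rnormB.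
  rewrite ltr_pdivlMr// mulrC in vn; apply: le_lt_trans vn.
  by rewrite ler_wpM2r ?rnorm_ge0.
rewrite (le_lt_trans (rnorm_amul _ _))// [rnorm (u n - _)]rnormB.
rewrite ltr_pdivlMr// in un; apply: le_lt_trans un.
by rewrite ler_wpM2l ?rnorm_ge0.
Qed.

Lemma clsA u : cls (linfty_adj u) = seq_adj (cls u).
Proof.
apply/clsP => e e0; have := rep_cls u e0; apply: filterS => n un.
by rewrite /= -adjN -adjD rnorm_adj rnormB.
Qed.

Lemma seqalg_ind (P : seqalg A -> Prop) : (forall u, P (cls u)) -> forall x, P x.
Proof. by move=> Pu x; rewrite -(repK x). Qed.

Lemma linfty_ext u v : (forall n, u n = v n) -> u = v.
Proof. by move=> uv; apply/val_inj/funext. Qed.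

Let seq_scalerA c d x : seq_scale c (seq_scale d x) = seq_scale (c * d) x.
Proof.
by elim/seqalg_ind: x => u; rewrite -!clsZ; congr cls; rewrite scalerA.
Qed.
Let seq_scale1r : left_id 1 seq_scale.
Proof. by elim/seqalg_ind => u; rewrite -clsZ scale1r. Qed.
Let seq_scalerDr : right_distributive seq_scale +%R.
Proof.
move=> c; elim/seqalg_ind => u; elim/seqalg_ind => v.
by rewrite -clsD -!clsZ -clsD scalerDr.
Qed.
Let seq_scalerDl x : {morph seq_scale^~ x : c d / c + d}.
Proof.
by elim/seqalg_ind: x => u c d; rewrite -!clsZ -clsD scalerDl.
Qed.

HB.instance Definition _ := GRing.Zmodule_isLmodule.Build R[i] (seqalg A)
  seq_scalerA seq_scale1r seq_scalerDr seq_scalerDl.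

Lemma clsZ' c u : cls (c *: u) = c *: cls u. Proof. exact: clsZ. Qed.

(* limsup_n |u_n|, which is the norm of the class of u in l^oo(A) / c_0(A) *)
Definition limsup_norm (u : nat -> A) : R :=
  inf [set r | \forall n \near \oo, rnorm (u n) <= r].

Lemma limsup_norm_le (u : nat -> A) (r : R) :
  (\forall n \near \oo, rnorm (u n) <= r) -> limsup_norm u <= r.
Proof.
move=> ur; apply: ge_inf => //; exists 0 => s /= us.
have [n un] := filter_ex us; exact: le_trans (rnorm_ge0 _) un.
Qed.

Lemma limsup_norm_lt u (r : R) :
  limsup_norm u < r -> \forall n \near \oo, rnorm (u n) < r.
Proof.
have [M [_ uM]] := linftyP u.
have S0 : [set r | \forall n \near \oo, rnorm (u n) <= r] !=set0.
  by exists M => /=; exact: nearW.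
move=> /(inf_lt S0)[s].
rewrite /= => us sr; apply: filterS us => n un; exact: le_lt_trans sr.
Qed.

Lemma limsup_norm_ge0 u : 0 <= limsup_norm u.
Proof.
rewrite leNgt; apply/negP => /limsup_norm_lt u0.
by have [n] := filter_ex u0; rewrite ltNge rnorm_ge0.
Qed.

Lemma limsup_norm_leP u (r : R) :
  (forall e, 0 < e -> \forall n \near \oo, rnorm (u n) < r + e) ->
  limsup_norm u <= r.
Proof.
move=> ur; apply/ler_addgt0Pr => e e0; apply: limsup_norm_le.
by apply: filterS (ur _ e0) => n; exact: ltW.
Qed.

Lemma limsup_norm_near u (e : R) : 0 < e ->
  \forall n \near \oo, rnorm (u n) < limsup_norm u + e.
Proof. by move=> e0; apply: limsup_norm_lt; rewrite ltrDl. Qed.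

Lemma limsup_norm_cls u v : cls u = cls v -> limsup_norm u = limsup_norm v.
Proof.
suff le w w' : cls w = cls w' -> limsup_norm w <= limsup_norm w'.
  by move=> uv; apply/eqP; rewrite eq_le !le.
move=> /clsP ww; apply: limsup_norm_leP => e e0.
have e20 : 0 < e / 2 by rewrite divr_gt0.
have := ww _ e20; have := limsup_norm_near w' e20; apply: filterS2 => n w'n wn.
rewrite -[w n](subrK (w' n)) addrC (le_lt_trans (rnormD _ _))//.
by rewrite [in ltRHS](splitr e) addrA ltrD.
Qed.

Definition seq_norm x : R[i] := (limsup_norm (rep x))%:C.

Lemma seq_norm_cls u : seq_norm (cls u) = (limsup_norm u)%:C.
Proof. by congr (_ %:C); apply: limsup_norm_cls; rewrite repK. Qed.

Let seq_normD x y : seq_norm (x + y) <= seq_norm x + seq_norm y.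
Proof.
elim/seqalg_ind: x => u; elim/seqalg_ind: y => v.
rewrite -clsD !seq_norm_cls -rmorphD lecR; apply: limsup_norm_leP => e e0.
have e20 : 0 < e / 2 by rewrite divr_gt0.
have := limsup_norm_near u e20; have := limsup_norm_near v e20.
apply: filterS2 => n vn un; rewrite linftyDE (le_lt_trans (rnormD _ _))//.
by rewrite (splitr e) addrACA ltrD.
Qed.

Lemma limsup_normZ_le c u :
  limsup_norm (c *: u) <= complex.Re `|c| * limsup_norm u.
Proof.
have c0 : 0 <= complex.Re `|c| by rewrite -lecR RRe_real ?realE ?normr_ge0.
apply: limsup_norm_leP => e e0.
have c1 : 0 < complex.Re `|c| + 1 by rewrite ltr_wpDl.
have := limsup_norm_near u (divr_gt0 e0 c1); apply: filterS => n un.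
rewrite linftyZE rnormZ (le_lt_trans (ler_wpM2l c0 (ltW un)))//.
rewrite mulrDr ltrD2l mulrCA -[ltRHS]mulr1 ltr_pM2l//.
by rewrite ltr_pdivrMr// mul1r ltrDl.
Qed.

Let seq_normZ c x : seq_norm (c *: x) = `|c| * seq_norm x.
Proof.
elim/seqalg_ind: x => u.
have cE : `|c| = (complex.Re `|c|)%:C by rewrite RRe_real ?realE ?normr_ge0.
rewrite -clsZ' !seq_norm_cls cE -rmorphM; congr (_ %:C).
have [->|c0] := eqVneq c 0.
  rewrite normr0 -[complex.Re 0]/0 mul0r scale0r; apply/eqP.
  rewrite eq_le limsup_norm_ge0 andbT; apply: limsup_norm_le.
  by apply: nearW => n; rewrite rnorm0.
apply/eqP; rewrite eq_le limsup_normZ_le/=.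
have cp : 0 < complex.Re `|c| by rewrite -ltcR -cE normr_gt0.
rewrite -ler_pdivlMl// -[X in limsup_norm (linfty_seq X) <= _](scalerK c0).
apply: le_trans (limsup_normZ_le _ _) _.
suff -> : complex.Re `|c^-1| = (complex.Re `|c|)^-1 by [].
by rewrite normfV {1}cE -fmorphV.
Qed.

Let seq_norm0_eq0 x : seq_norm x = 0 -> x = 0.
Proof.
elim/seqalg_ind: x => u; rewrite seq_norm_cls => /complexI u0.
have -> : 0 = cls 0 by rewrite /cls piE.
apply/clsP => e e0; have := limsup_norm_near u e0; rewrite u0 add0r.
by apply: filterS => n; rewrite subr0.
Qed.

HB.instance Definition _ := Lmodule_isNormed.Build R[i] (seqalg A)
  seq_normD seq_normZ seq_norm0_eq0.

Lemma rnorm_cls u : rnorm (cls u) = limsup_norm u.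
Proof. by rewrite /rnorm -[LHS]/(complex.Re (seq_norm _)) seq_norm_cls. Qed.

End SequenceAlgebra.

Section SequenceAlgebraComplete.
Context {R : realType} {A : cstarAlgType R}.
Implicit Types (u v w : linfty A) (x y z : seqalg A).

Lemma seqalg_complete (F : set_system (seqalg A)) :
  ProperFilter F -> cauchy F -> cvg F.
Proof.
apply: complete_fast_cauchy => X dX.
have p0 k : 0 < 2^-1 ^+ k :> R by rewrite exprn_gt0// invr_gt0.
pose D k := rep (X k.+1 - X k).
pose Vf k n := if rnorm (D k n) < 2^-1 ^+ k then D k n else 0.
have Vf_le k n : rnorm (Vf k n) <= 2^-1 ^+ k.
  by rewrite /Vf; case: ifPn => [/ltW//|_]; rewrite rnorm0 ltW.
have Vfb k : Vf k \in @bounded_seq R A by apply/bounded_seqP; exists (2^-1 ^+ k).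
pose V k := Linfty (Vfb k).
have clsV k : cls (V k) = X k.+1 - X k.
  rewrite -[RHS]repK; apply/clsP => e e0.
  have := limsup_norm_lt (u := D k); rewrite -rnorm_cls repK.
  move=> /(_ _ (dX k)); apply: filterS => n Dn.
  by rewrite /= /Vf Dn subrr rnorm0.
pose S k := iteri k (fun j (s : linfty A) => s + V j) (rep (X 0%N)).
have SE k n : S k.+1 n = S k n + Vf k n by [].
have clsS k : cls (S k) = X k.
  by elim: k => [|k IH]; rewrite ?repK//= clsD IH clsV addrC subrK.
have dS K m n : rnorm (S K n - S (K + m)%N n) <= 2 * 2^-1 ^+ K * (1 - 2^-1 ^+ m).
  elim: m => [|m IH]; first by rewrite addn0 !subrr rnorm0 mulr0.
  rewrite addnS SE opprD addrA (le_trans (rnormD _ _))// rnormN.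
  apply: le_trans (lerD IH (Vf_le _ _)) _.
  by rewrite exprD exprS; nra.
have dS' K k n : (K <= k)%N -> rnorm (S K n - S k n) <= 2 * 2^-1 ^+ K.
  move=> /subnKC <-; apply: le_trans (dS _ _ _) _.
  by rewrite ler_piMr ?mulr_ge0// ?ltW// ltrBlDr ltrDl.
have geo (e : R) : 0 < e -> \forall K \near \oo, 2 * 2^-1 ^+ K < e.
  move=> e0; have e20 : 0 < e / 2 by rewrite divr_gt0.
  have /cvgrPdist_lt/(_ _ e20) : (2^-1 : R) ^+ n @[n --> \oo] --> (0 : R).
    by apply: cvg_expr; rewrite ger0_norm ?invr_ge0// invf_lt1// ltr1n.
  apply: filterS => n; rewrite sub0r normrN ger0_norm ?(ltW (p0 _))//.
  by rewrite ltr_pdivlMr// mulrC.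
have cS n : cvg (S k n @[k --> \oo]).
  apply: cauchy_seq_cvg => e e0; have [N _ NP] := geo _ e0.
  by exists N => m Nm; rewrite (le_lt_trans (dS' _ _ _ Nm))//; exact: NP (leqnn _).
pose L n := lim (S k n @[k --> \oo]).
have SL K n : rnorm (S K n - L n) <= 2 * 2^-1 ^+ K.
  apply/ler_addgt0Pr => e e0.
  have /cvg_rnormP/(_ _ e0)[N _ NP] : S k n @[k --> \oo] --> L n := cS n.
  have := NP (maxn N K); rewrite /= leq_maxl => /(_ isT) LS.
  rewrite -[S K n](subrK (S (maxn N K) n)) -addrA (le_trans (rnormD _ _))//.
  by rewrite lerD ?dS' ?leq_maxr// rnormB ltW.
have Lb : L \in @bounded_seq R A.
  have [M [M0 uM]] := linftyP (S 0%N).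
  apply/bounded_seqP; exists (M + 2) => n.
  rewrite -[L n](subrK (S 0%N n)) addrC (le_trans (rnormD _ _))// lerD//.
  by rewrite rnormB (le_trans (SL _ _))// expr0 mulr1.
apply/cvg_ex; exists (cls (Linfty Lb)); apply/cvg_rnormP => e e0.
apply: filterS (geo _ e0) => K; apply: le_lt_trans.
rewrite -clsS -clsN -clsD rnorm_cls; apply: limsup_norm_le.
by apply: nearW => n; rewrite -rnormN opprB; exact: SL.
Qed.

HB.instance Definition _ :=
  Uniform_isComplete.Build (seqalg A) seqalg_complete.

Let mulA : associative (@seq_mul R A).
Proof.
elim/(@seqalg_ind R A) => u; elim/(@seqalg_ind R A) => v; elim/(@seqalg_ind R A) => w.
by rewrite -!clsM; congr cls; apply: linfty_ext => n /=; rewrite amulA.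
Qed.
Let mulDl : left_distributive (@seq_mul R A) +%R.
Proof.
elim/(@seqalg_ind R A) => u; elim/(@seqalg_ind R A) => v; elim/(@seqalg_ind R A) => w.
rewrite -clsD -!clsM -clsD; congr cls.
by apply: linfty_ext => n /=; rewrite ?linftyDE amulDl.
Qed.
Let mulDr : right_distributive (@seq_mul R A) +%R.
Proof.
elim/(@seqalg_ind R A) => u; elim/(@seqalg_ind R A) => v; elim/(@seqalg_ind R A) => w.
rewrite -clsD -!clsM -clsD; congr cls.
by apply: linfty_ext => n /=; rewrite ?linftyDE amulDr.
Qed.
Let mulZl (c : R[i]) x y : seq_mul (c *: x) y = c *: seq_mul x y.
Proof.
elim/(@seqalg_ind R A): x => u; elim/(@seqalg_ind R A): y => v.
rewrite -clsZ' -!clsM -clsZ'; congr cls.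
by apply: linfty_ext => n /=; rewrite ?linftyZE amulZl.
Qed.
Let mulZr (c : R[i]) x y : seq_mul x (c *: y) = c *: seq_mul x y.
Proof.
elim/(@seqalg_ind R A): x => u; elim/(@seqalg_ind R A): y => v.
rewrite -clsZ' -!clsM -clsZ'; congr cls.
by apply: linfty_ext => n /=; rewrite ?linftyZE amulZr.
Qed.
Let sadjK : involutive (@seq_adj R A).
Proof.
elim/(@seqalg_ind R A) => u; rewrite -!clsA; congr cls.
by apply: linfty_ext => n /=; rewrite adjK.
Qed.
Let sadjD : {morph @seq_adj R A : x y / x + y}.
Proof.
elim/(@seqalg_ind R A) => u; elim/(@seqalg_ind R A) => v.
rewrite -clsD -!clsA -clsD; congr cls.
by apply: linfty_ext => n /=; rewrite ?linftyDE adjD.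
Qed.
Let sadjZ (c : R[i]) x : seq_adj (c *: x) = Num.conj c *: seq_adj x.
Proof.
elim/(@seqalg_ind R A): x => u; rewrite -clsZ' -!clsA -clsZ'; congr cls.
by apply: linfty_ext => n /=; rewrite ?linftyZE adjZ.
Qed.
Let sadjM x y : seq_adj (seq_mul x y) = seq_mul (seq_adj y) (seq_adj x).
Proof.
elim/(@seqalg_ind R A): x => u; elim/(@seqalg_ind R A): y => v.
rewrite -[in LHS]clsM -!clsA -clsM; congr cls.
by apply: linfty_ext => n /=; rewrite adjM.
Qed.
Let snorm_mul x y : `|seq_mul x y| <= `|x| * `|y| :> R[i].
Proof.
elim/(@seqalg_ind R A): x => u; elim/(@seqalg_ind R A): y => v.
rewrite -clsM !rnormE -rmorphM lecR !rnorm_cls.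
apply: limsup_norm_leP => e e0.
set a := limsup_norm u; set b := limsup_norm v.
have a0 : 0 <= a by exact: limsup_norm_ge0.
have b0 : 0 <= b by exact: limsup_norm_ge0.
have c1 : 0 < a + b + 1 by rewrite ltr_wpDl// addr_ge0.
pose d := Num.min 1 (e / (a + b + 1)).
have d0 : 0 < d by rewrite lt_min ltr01 divr_gt0.
have := limsup_norm_near u d0; have := limsup_norm_near v d0.
apply: filterS2 => n vn un.
apply: le_lt_trans (rnorm_amul _ _) _.
apply: (@lt_le_trans _ _ ((a + d) * (b + d))).
  by rewrite ltr_pM ?rnorm_ge0.
have d1 : d <= 1 by rewrite ge_min lexx.
have de : d * (a + b + 1) <= e.
  by rewrite -ler_pdivlMr// ge_min lexx orbT.
by nra.
Qed.
Let snorm_adjM x : `|seq_mul (seq_adj x) x| = `|x| ^+ 2 :> R[i].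
Proof.
elim/(@seqalg_ind R A): x => u.
rewrite -clsA -clsM !rnormE -rmorphXn; congr (_ %:C); rewrite !rnorm_cls.
set a := limsup_norm u; have a0 : 0 <= a by exact: limsup_norm_ge0.
apply/eqP; rewrite eq_le; apply/andP; split.
  apply: limsup_norm_leP => e e0.
  have c1 : 0 < a + a + 1 by rewrite ltr_wpDl// addr_ge0.
  pose d := Num.min 1 (e / (a + a + 1)).
  have d0 : 0 < d by rewrite lt_min ltr01 divr_gt0.
  have := limsup_norm_near u d0; apply: filterS => n un /=.
  rewrite rnorm_adjM; apply: (@lt_le_trans _ _ ((a + d) ^+ 2)).
    by rewrite ltr_pXn2r// nnegrE ?rnorm_ge0// addr_ge0// ltW.
  have d1 : d <= 1 by rewrite ge_min lexx.
  have de : d * (a + a + 1) <= e.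
    by rewrite -ler_pdivlMr// ge_min lexx orbT.
  by nra.
set b := limsup_norm _; have b0 : 0 <= b by exact: limsup_norm_ge0.
rewrite -(sqr_sqrtr b0) ler_pXn2r ?nnegrE ?sqrtr_ge0//.
apply: limsup_norm_leP => e e0.
have c0 : 0 < e ^+ 2 by rewrite exprn_gt0.
have := limsup_norm_near (linfty_mul (linfty_adj u) u) c0.
apply: filterS => n /=; rewrite rnorm_adjM -/b => un.
rewrite -(@ltr_pXn2r _ 2)// ?nnegrE ?rnorm_ge0 ?addr_ge0 ?sqrtr_ge0 ?(ltW e0)//.
apply: lt_le_trans un _; rewrite sqrrD sqr_sqrtr// lerD2r lerDl.
by rewrite mulrn_wge0// mulr_ge0 ?sqrtr_ge0// ltW.
Qed.

HB.instance Definition _ := CompleteNormedModule_isCStarAlgebra.Build R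
  (seqalg A) mulA mulDl mulDr mulZl mulZr sadjK sadjD sadjZ sadjM
  snorm_mul snorm_adjM.

End SequenceAlgebraComplete.

(* The class in A_oo of a sequence; junk value 0 when it is unbounded. *)
Definition seq_class (R : realType) (A : cstarAlgType R) (u : nat -> A) :
  seqalg A := if insub u is Some v then cls v else 0.

Lemma seq_classE (R : realType) (A : cstarAlgType R) (v : linfty A) :
  seq_class v = cls v.
Proof. by rewrite /seq_class valK. Qed.

(* A embeds in A_oo as the constant sequences. *)
Definition seq_const (R : realType) (A : cstarAlgType R) (a : A) : seqalg A :=
  seq_class (fun=> a).

(* The map f_oo : A_oo -> B_oo that applies f componentwise; by [seq_map_class]
   it does not depend on the representative when f is bounded and linear. *)
Definition seq_map (R : realType) (A B : cstarAlgType R) (f : A -> B)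
  (x : seqalg A) : seqalg B := seq_class (fun n => f (rep x n)).

Lemma seq_map_class (R : realType) (A B : cstarAlgType R) (f : {linear A -> B})
    (c : R) (u : nat -> A) :
  (forall x, `|f x| <= c%:C * `|x|) -> u \in @bounded_seq R A ->
  seq_map f (seq_class u) = seq_class (f \o u).
Proof.
move=> fc ub; have fr x : rnorm (f x) <= c * rnorm x.
  by rewrite -lecR rmorphM/= -!rnormE.
have c0 : 0 < `|c| + 1 by rewrite ltr_wpDl.
have fr' x : rnorm (f x) <= (`|c| + 1) * rnorm x.
  rewrite (le_trans (fr x))// ler_wpM2r ?rnorm_ge0//.
  by rewrite (le_trans (ler_norm _))// lerDl.
have fb (v : linfty A) : (f \o v) \in @bounded_seq R B.
  have [M [M0 vM]] := linftyP v; apply/bounded_seqP; exists ((`|c| + 1) * M) => n.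
  by rewrite (le_trans (fr' _))// ler_pM2l.
pose v := Linfty ub; rewrite -[u]/(linfty_seq v) /seq_map seq_classE.
rewrite -[X in _ = seq_class X]/(linfty_seq (Linfty (fb v))).
rewrite -[X in seq_class X = _]/(linfty_seq (Linfty (fb (rep (cls v))))).
rewrite !seq_classE.
apply/clsP => e e0; have := rep_cls v (divr_gt0 e0 c0); apply: filterS => n vn.
rewrite /= -linearB (le_lt_trans (fr' _))// mulrC.
by rewrite -ltr_pdivlMr.
Qed.

Section SequentiallySplit.
Context {R : realType} {A B : cstarAlgType R}.

Definition seq_split (f : {linear A -> B}) : Prop :=
  star_hom f /\
  exists psi : {linear B -> seqalg A},
    star_hom psi /\ forall a, psi (f a) = seq_const a.

End SequentiallySplit.

(* The Hilbert space tensor product of H and K, given by a Hilbert space in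
   which the algebraic tensor product of H and K is dense; it is determined up
   to a unique unitary. *)
Record hilbert_tensor (R : realType) (H K : hilbertType R) := {
  ht_space :> hilbertType R;
  ht_tens : {bilinear H -> K -> ht_space};
  inner_ht : forall h h' k k',
    inner (ht_tens h k) (ht_tens h' k') = inner h h' * inner k k';
  ht_dense : cspan [set x | exists h k, x = ht_tens h k] = setT
}.

(* The minimal (spatial) tensor product of A in L(H) and B in L(K): the closed
   linear span in L(H (x) K) of the operators a (x) b. It is determined up to a
   unique isometric *-isomorphism compatible with elementary tensors, and does
   not depend on the choice of the faithful representations of A and B. *)
Record min_tensor (R : realType) (A B : concreteCstar R) := {
  mt_alg : cstarAlgType R;
  mt_space : hilbert_tensor (cc_space A) (cc_space B);
  mt_rep : faithful_rep mt_alg mt_space;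
  tens : {bilinear A -> B -> mt_alg};
  tensM : forall a a' b b', tens a b ** tens a' b' = tens (a ** a') (b ** b');
  tens_adj : forall a b, adj (tens a b) = tens (adj a) (adj b);
  act_tens : forall a b h k, mt_rep (tens a b) (ht_tens mt_space h k) =
    ht_tens mt_space (cc_rep A a h) (cc_rep B b k);
  tens_dense : cspan [set x | exists a b, x = tens a b] = setT
}.

Definition mt_concrete (R : realType) (A B : concreteCstar R)
  (T : min_tensor A B) : concreteCstar R := ConcreteCstar (mt_rep T).
Coercion mt_concrete : min_tensor >-> concreteCstar.

Section TensorMaps.
Context {R : realType} {A B : concreteCstar R}.

(* F is the continuous linear extension of a (x) b |-> f a b. *)
Definition tensor_extends (T : min_tensor A B) (V : normedModType R[i])
    (f : A -> B -> V) (F : {linear T -> V}) : Prop :=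
  continuous F /\ forall a b, F (tens T a b) = f a b.

End TensorMaps.
Arguments tensor_extends {R A B} T {V} f F.

Definition short_exact (R : realType) (J B Q : cstarAlgType R)
    (i : {linear J -> B}) (q : {linear B -> Q}) : Prop :=
  [/\ injective i, forall b, q b = 0 <-> exists j, i j = b
    & forall c, exists b, q b = c].

(* C (x) - preserves short exact sequences of C*-algebras. *)
Definition exact_cstar (R : realType) (C : concreteCstar R) : Prop :=
  forall (J B Q : concreteCstar R) (i : {linear J -> B}) (q : {linear B -> Q}),
    star_hom i -> star_hom q -> short_exact i q ->
  forall (CJ : min_tensor C J) (CB : min_tensor C B) (CQ : min_tensor C Q),
  exists (idi : {linear CJ -> CB}) (idq : {linear CB -> CQ}),
    [/\ tensor_extends CJ (fun c j => tens CB c (i j)) idi,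
        tensor_extends CB (fun c b => tens CQ c (q b)) idq
      & short_exact idi idq].

(* (Delta (x) id) alpha = (id (x) alpha) alpha, where
   assoc : (C (x) C) (x) A -> C (x) (C (x) A) is the canonical identification. *)
Definition coaction_identity (R : realType) (C A : concreteCstar R)
    (CC : min_tensor C C) (CA : min_tensor C A)
    (Delta : {linear C -> CC}) (alpha : {linear A -> CA}) : Prop :=
  exists (CC_A : min_tensor CC A) (C_CA : min_tensor C CA)
    (Delta_id : {linear CA -> CC_A}) (id_alpha : {linear CA -> C_CA})
    (assoc : {linear CC_A -> C_CA}),
    [/\ tensor_extends CA (fun g a => tens CC_A (Delta g) a) Delta_id,
        tensor_extends CA (fun g a => tens C_CA g (alpha a)) id_alpha,
        continuous assoc,
        forall g h a, assoc (tens CC_A (tens CC g h) a)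
          = tens C_CA g (tens CA h a)
      & forall a, assoc (Delta_id (alpha a)) = id_alpha (alpha a)].

(* A compact quantum group in the reduced setting. The algebra C^r(G) acts on
   cc_space = L^2(G), the GNS space of the Haar state, with cyclic vector
   cqg_vec; the Haar state is the corresponding vector state. *)
Record compact_quantum_group (R : realType) := {
  cqg_alg :> concreteCstar R;
  cqg_one : cqg_alg;
  cqg_mul1l : forall x, cqg_one ** x = x;
  cqg_mul1r : forall x, x ** cqg_one = x;
  cqg_vec : cc_space cqg_alg;
  haar : cqg_alg -> R[i] := fun x => inner (cc_rep cqg_alg x cqg_vec) cqg_vec;
  cqg_vec_norm : `|cqg_vec| = 1 :> R[i];
  cqg_vec_cyclic :
    closure [set h | exists x, h = cc_rep cqg_alg x cqg_vec] = setT;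
  cqg_separable :
    exists D : set (cc_space cqg_alg), countable D /\ closure D = setT;
  cqg_tens : min_tensor cqg_alg cqg_alg;
  comul : {linear cqg_alg -> cqg_tens};
  comul_hom : star_hom comul;
  comul1 : comul cqg_one = tens cqg_tens cqg_one cqg_one;
  comul_coassoc : coaction_identity comul comul;
  cqg_cancell : cspan [set y | exists x g,
    y = comul x ** tens cqg_tens g cqg_one] = setT;
  cqg_cancelr : cspan [set y | exists x g,
    y = comul x ** tens cqg_tens cqg_one g] = setT;
  haar_invl : exists S : {linear cqg_tens -> cqg_alg},
    tensor_extends cqg_tens (fun x y => haar x *: y) S /\
    forall x, S (comul x) = haar x *: cqg_one;
  haar_invr : exists S : {linear cqg_tens -> cqg_alg},
    tensor_extends cqg_tens (fun x y => haar y *: x) S /\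
    forall x, S (comul x) = haar x *: cqg_one
}.

(* This is equivalent to the exactness of the dual of G, i.e. of the functor of
   reduced crossed products by the dual. *)
Definition coexact (R : realType) (G : compact_quantum_group R) : Prop :=
  exact_cstar G.

Record G_cstar (R : realType) (G : compact_quantum_group R) := {
  gc_alg :> concreteCstar R;
  gc_tens : min_tensor G gc_alg;
  coact : {linear gc_alg -> gc_tens};
  coact_hom : star_hom coact;
  coact_inj : injective coact;
  coact_nondeg :
    cspan [set y | exists a (x : gc_tens), y = coact a ** x] = setT;
  coactP : coaction_identity (@comul R G) coact;
  (* [alpha(A) (C^r(G) (x) 1)] = C^r(G) (x) A; as A need not be unital, g (x) 1
     is the operator h (x) k |-> g h (x) k. *)
  coact_podles : cspan [set y | exists a g, forall h k,
    mt_rep gc_tens y (ht_tens (mt_space gc_tens) h k) =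
    mt_rep gc_tens (coact a) (ht_tens (mt_space gc_tens) (cc_rep G g h) k)]
    = setT
}.

Section Equivariance.
Context {R : realType} {G : compact_quantum_group R} {A B : G_cstar G}.

(* beta phi = (id (x) phi) alpha *)
Definition equivariant (phi : {linear A -> B}) : Prop :=
  star_hom phi /\
  exists id_phi : {linear gc_tens A -> gc_tens B},
    tensor_extends (gc_tens A) (fun g a => tens (gc_tens B) g (phi a)) id_phi /\
    forall a, coact B (phi a) = id_phi (coact A a).

(* alpha_oo psi = (id (x) psi) beta as maps B -> (C^r(G) (x) A)_oo. Here A_oo
   acts on some Hilbert space through rho, and incl is the canonical inclusion
   C^r(G) (x) A_oo -> (C^r(G) (x) A)_oo, g (x) [a_n] |-> [g (x) a_n]. *)
Definition seq_equivariant (psi : {linear B -> seqalg A}) : Prop :=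
  star_hom psi /\
  exists (H : hilbertType R) (rho : faithful_rep (seqalg A) H)
    (CAoo : min_tensor G (ConcreteCstar rho))
    (id_psi : {linear gc_tens B -> CAoo})
    (incl : {linear CAoo -> seqalg (mt_alg (gc_tens A))}),
    [/\ tensor_extends (gc_tens B) (fun g b => tens CAoo g (psi b)) id_psi,
        tensor_extends CAoo (fun g x => seq_map (tens (gc_tens A) g) x) incl
      & forall b, seq_map (coact A) (psi b) = incl (id_psi (coact B b))].

Definition eq_seq_split (phi : {linear A -> B}) : Prop :=
  equivariant phi /\
  exists psi : {linear B -> seqalg A},
    seq_equivariant psi /\ forall a, psi (phi a) = seq_const a.

End Equivariance.

Section FixedPoints.
Context {R : realType} {G : compact_quantum_group R} (A : G_cstar G).

Let one_tens : {linear A -> mt_alg (gc_tens A)} := tens (gc_tens A) (cqg_one G).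

Lemma adj_one : adj (cqg_one G) = cqg_one G.
Proof.
have := adjM (cqg_one G) (adj (cqg_one G)).
by rewrite adjK !cqg_mul1l adjK => <-.
Qed.

Lemma one_tens_hom : star_hom one_tens.
Proof. by split=> [x y|x]; rewrite /one_tens/= ?tensM ?tens_adj ?cqg_mul1l ?adj_one. Qed.

(* the fixed point algebra A^alpha *)
Definition fixed : {pred A} :=
  fun a => coact A a == tens (gc_tens A) (cqg_one G) a.

Lemma fixedP a : reflect (coact A a = tens (gc_tens A) (cqg_one G) a) (a \in fixed).
Proof. exact: eqP. Qed.

Lemma fixed_submod_closed : submod_closed fixed.
Proof.
split=> [|c a b /fixedP ha /fixedP hb]; apply/fixedP.
  by rewrite linear0 -[RHS]/(one_tens 0) linear0.
by rewrite linearP ha hb -[RHS]/(one_tens (c *: a + b)) linearP.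
Qed.
HB.instance Definition _ := GRing.isSubmodClosed.Build R[i] A
  fixed fixed_submod_closed.

Lemma fixedM a b : a \in fixed -> b \in fixed -> a ** b \in fixed.
Proof.
move=> /fixedP ha /fixedP hb; apply/fixedP.
by rewrite (coact_hom A).1 ha hb one_tens_hom.1.
Qed.

Lemma fixed_adj a : a \in fixed -> adj a \in fixed.
Proof.
by move=> /fixedP ha; apply/fixedP; rewrite (coact_hom A).2 ha one_tens_hom.2.
Qed.

Lemma fixed_closed (u : nat -> A) (l : A) :
  (forall n, u n \in fixed) -> u n @[n --> \oo] --> l -> l \in fixed.
Proof.
move=> uf /cvg_rnormP ul; apply/fixedP/subr0_eq/rnorm0_eq0.
apply/eqP; rewrite eq_le rnorm_ge0 andbT; apply/ler_addgt0Pl => e e0.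
have e20 : 0 < e / 2 by rewrite divr_gt0.
rewrite addr0; have [n ln] := filter_ex (ul _ e20).
have -> : coact A l - tens (gc_tens A) (cqg_one G) l =
    coact A (l - u n) - one_tens (l - u n).
  have /fixedP un := uf n.
  rewrite [one_tens _]linearB [coact A (_ - _)]linearB un.
  by rewrite opprB addrA subrK.
rewrite (splitr e).
rewrite (le_trans (rnormD _ _))// rnormN lerD// (le_trans _ (ltW ln))//.
  by rewrite -lecR -!rnormE (star_hom_norm (mt_rep (gc_tens A)) (coact_hom A)).
by rewrite -lecR -!rnormE (star_hom_norm (mt_rep (gc_tens A)) one_tens_hom).
Qed.

Record fixalg := Fixalg { fix_val :> A; fix_valP : fix_val \in fixed }.
HB.instance Definition _ := [isSub for fix_val].
HB.instance Definition _ := [Choice of fixalg by <:].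
HB.instance Definition _ := [SubChoice_isSubLmodule of fixalg by <:].

Let fnorm (x : fixalg) : R[i] := `|fix_val x|.
Let fnormD x y : fnorm (x + y) <= fnorm x + fnorm y.
Proof. exact: ler_normD. Qed.
Let fnormZ (c : R[i]) x : fnorm (c *: x) = `|c| * fnorm x.
Proof. exact: normrZ. Qed.
Let fnorm0_eq0 x : fnorm x = 0 -> x = 0.
Proof. by move=> x0; apply/val_inj/normr0_eq0. Qed.
HB.instance Definition _ := Lmodule_isNormed.Build R[i] fixalg
  fnormD fnormZ fnorm0_eq0.

Lemma fixalg_complete (F : set_system fixalg) :
  ProperFilter F -> cauchy F -> cvg F.
Proof.
apply: complete_fast_cauchy => u du.
have dv n : rnorm (fix_val (u n.+1) - fix_val (u n)) < 2^-1 ^+ n by exact: du.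
have half : (2^-1 : R) < 1 by rewrite invf_lt1// ltr1n.
have p0 k : 0 < 2^-1 ^+ k :> R by rewrite exprn_gt0// invr_gt0.
have dS K m : rnorm (fix_val (u K) - fix_val (u (K + m)%N)) <=
    2 * 2^-1 ^+ K * (1 - 2^-1 ^+ m).
  elim: m => [|m IH]; first by rewrite addn0 !subrr rnorm0 mulr0.
  rewrite -[fix_val (u K)](subrK (fix_val (u (K + m)%N))) -addrA.
  rewrite (le_trans (rnormD _ _))// addnS.
  rewrite [X in _ + X <= _]rnormB; apply: le_trans (lerD IH (ltW (dv _))) _.
  by rewrite exprD exprS; nra.
have dS' K k : (K <= k)%N ->
    rnorm (fix_val (u K) - fix_val (u k)) <= 2 * 2^-1 ^+ K.
  move=> /subnKC <-; apply: le_trans (dS _ _) _.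
  by rewrite ler_piMr ?mulr_ge0// ?ltW// ltrBlDr ltrDl.
have geo (e : R) : 0 < e -> \forall K \near \oo, 2 * 2^-1 ^+ K < e.
  move=> e0; have e20 : 0 < e / 2 by rewrite divr_gt0.
  have /cvgrPdist_lt/(_ _ e20) : (2^-1 : R) ^+ n @[n --> \oo] --> (0 : R).
    by apply: cvg_expr; rewrite ger0_norm ?invr_ge0.
  apply: filterS => n; rewrite sub0r normrN ger0_norm ?(ltW (p0 _))//.
  by rewrite ltr_pdivlMr// mulrC.
have /cvg_ex[l ul] : cvg (fix_val (u n) @[n --> \oo]).
  apply: cauchy_seq_cvg => e e0; have [N _ NP] := geo _ e0.
  by exists N => m Nm; rewrite (le_lt_trans (dS' _ _ Nm))//; exact: NP (leqnn _).
have lf : l \in fixed by apply: fixed_closed ul => n; exact: fix_valP.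
apply/cvg_ex; exists (Fixalg lf); apply/cvg_rnormP => e e0.
by move/cvg_rnormP : ul => /(_ _ e0).
Qed.
HB.instance Definition _ := Uniform_isComplete.Build fixalg fixalg_complete.

Let fmul (x y : fixalg) := Fixalg (fixedM (fix_valP x) (fix_valP y)).
Let fadj (x : fixalg) := Fixalg (fixed_adj (fix_valP x)).
Let fmulA : associative fmul.
Proof. by move=> x y z; apply/val_inj; rewrite /= amulA. Qed.
Let fmulDl : left_distributive fmul +%R.
Proof. by move=> x y z; apply/val_inj; rewrite /= amulDl. Qed.
Let fmulDr : right_distributive fmul +%R.
Proof. by move=> x y z; apply/val_inj; rewrite /= amulDr. Qed.
Let fmulZl (c : R[i]) x y : fmul (c *: x) y = c *: fmul x y.
Proof. by apply/val_inj; rewrite /= amulZl. Qed.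
Let fmulZr (c : R[i]) x y : fmul x (c *: y) = c *: fmul x y.
Proof. by apply/val_inj; rewrite /= amulZr. Qed.
Let fadjK : involutive fadj.
Proof. by move=> x; apply/val_inj; rewrite /= adjK. Qed.
Let fadjD : {morph fadj : x y / x + y}.
Proof. by move=> x y; apply/val_inj; rewrite /= adjD. Qed.
Let fadjZ (c : R[i]) x : fadj (c *: x) = Num.conj c *: fadj x.
Proof. by apply/val_inj; rewrite /= adjZ. Qed.
Let fadjM x y : fadj (fmul x y) = fmul (fadj y) (fadj x).
Proof. by apply/val_inj; rewrite /= adjM. Qed.
Let fnorm_mul x y : `|fmul x y| <= `|x| * `|y| :> R[i].
Proof. exact: norm_amul. Qed.
Let fnorm_adjM x : `|fmul (fadj x) x| = `|x| ^+ 2 :> R[i].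
Proof. exact: norm_adjM. Qed.

HB.instance Definition _ := CompleteNormedModule_isCStarAlgebra.Build R fixalg
  fmulA fmulDl fmulDr fmulZl fmulZr fadjK fadjD fadjZ fadjM fnorm_mul fnorm_adjM.

End FixedPoints.
Arguments fixed {R G} A.
Arguments fixalg {R G} A.

Section FixedMap.
Context {R : realType} {G : compact_quantum_group R} {A B : G_cstar G}.
Variables (phi : {linear A -> B}) (phi_eq : equivariant phi).

Lemma fixed_map a : a \in fixed A -> phi a \in fixed B.
Proof.
case: phi_eq => _ [id_phi [[_ ext] eqv]] /fixedP ha; apply/fixedP.
by rewrite eqv ha ext.
Qed.

(* the restriction A^alpha -> B^beta of an equivariant *-homomorphism *)
Definition fix_map (a : fixalg A) : fixalg B := Fixalg (fixed_map (fix_valP a)).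

Let fix_map_linear : linear fix_map.
Proof. by move=> c a b; apply/val_inj; rewrite /= linearP. Qed.
HB.instance Definition _ := GRing.isLinear.Build R[i] (fixalg A) (fixalg B)
  _ fix_map fix_map_linear.

End FixedMap.

(* Main.v *)
Require Import Defs.
From HB Require Import structures.
From mathcomp Require Import all_boot all_order all_algebra.
From mathcomp Require Import complex.
From mathcomp Require Import boolp classical_sets reals topology normedtype.
From mathcomp Require Import sequences.
From mathcomp Require Import ring.
Set Implicit Arguments.
Unset Strict Implicit.
Unset Printing Implicit Defensive.
Import Order.TTheory GRing.Theory Num.Theory.
Import numFieldNormedType.Exports.
Local Open Scope classical_set_scope.
Local Open Scope complex_scope.
Local Open Scope ring_scope.

(** The Haar state gives a conditional expectation E = (h (x) id) alpha of A
    onto the fixed point algebra: it is contractive, and its values are fixed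
    because h is left invariant ([average_fixed]).  Moreover h (1) = 1 yields
      E a - a = (h (x) id) (alpha a - 1 (x) a),
    so E moves a by at most the defect |alpha a - 1 (x) a| ([average_dist]).

    If psi : B -> A_oo is an equivariant splitting and b is fixed by beta, then
    alpha_oo (psi b) = 1 (x) psi b, that is, any sequence (a_n) that represents
    psi b satisfies alpha a_n - 1 (x) a_n -> 0 ([seq_equivariant_fixed]).  Hence
    E a_n - a_n -> 0, and psi b is also represented by the sequence (E a_n),
    which lies in A^alpha ([cls_expectation]).  As A^alpha is isometrically
    embedded in A, the class of (E a_n) in (A^alpha)_oo is determined by psi b;
    this uniqueness makes b |-> [E a_n] a *-homomorphism that splits the
    restriction of phi.

    This rests on two facts about minimal tensor products.  The slice map h (x) id
    exists and is contractive: it is the compression by the isometry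
    k |-> xi (x) k, where h is the vector state of xi ([slice]).  And
    y |-> y (x) a is bounded when the first factor is unital ([tens_le_unit]);
    so identities that hold for y = g1 (x) g2 extend to y = Delta g. *)

(** * Bounded linear maps and dense spans *)

Section Density.
Context {R : realType}.
Implicit Types V W : normedModType R[i].

Lemma bounded_continuous V W (F : {linear V -> W}) (M : R) :
  (forall x, rnorm (F x) <= M * rnorm x) -> continuous F.
Proof.
move=> FM x; apply/cvgrPdist_lt => e /Re_gt0[e0 ->].
have M0 : 0 < `|M| + 1 by rewrite ltr_wpDl.
apply/nbhs_normP; exists ((complex.Re e / (`|M| + 1))%:C).
  by rewrite /= ltcR divr_gt0.
move=> y /=; rewrite -!rnorm_lt -linearB ltr_pdivlMr// mulrC.
apply: le_lt_trans; apply: le_trans (FM _) _.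
by rewrite ler_wpM2r ?rnorm_ge0// (le_trans (ler_norm _))// lerDl.
Qed.

Lemma closure_approx V (S : set V) x (e : R) :
  closure S x -> 0 < e -> exists2 y, S y & rnorm (x - y) < e.
Proof.
move=> Sx e0.
have [|y [Sy xy]] := Sx (ball x e%:C).
  by apply: nbhsx_ballx; rewrite ltcR.
by exists y => //; rewrite rnorm_lt; move: xy; rewrite -ball_normE.
Qed.

Lemma linear_eq_closure V W (F G : {linear V -> W}) (S : set V) :
  continuous F -> continuous G -> {in S, F =1 G} ->
  forall x, closure S x -> F x = G x.
Proof.
move=> Fc Gc FG x Sx; apply/eqP; rewrite -subr_eq0; apply/eqP.
have cE : closed [set y | F y - G y = 0].
  apply: (@preimage_closed _ _ (fun y => F y - G y) [set 0]).
    by move=> y _; apply: cvgB; [exact: Fc|exact: Gc].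
  exact/accessible_closed_set1/hausdorff_accessible/norm_hausdorff.
apply: cE; apply: closureS Sx => y Sy /=.
by rewrite FG ?subrr// inE.
Qed.

Lemma linear_eq_cspan V W (F G : {linear V -> W}) (S : set V) :
  continuous F -> continuous G -> cspan S = setT -> {in S, F =1 G} ->
  F =1 G.
Proof.
move=> Fc Gc ST FG x.
have : cspan S x by rewrite ST.
apply: linear_eq_closure => // _ /set_mem[n [c [v [Sv ->]]]]; rewrite !linear_sum.
by apply: eq_bigr => k _; rewrite !linearZ FG ?inE.
Qed.

End Density.

Section TensorDensity.
Context {R : realType} {C A : concreteCstar R} (T : min_tensor C A).

Lemma tensor_ext (W : normedModType R[i]) (F G : {linear T -> W}) :
  continuous F -> continuous G ->
  (forall g a, F (tens T g a) = G (tens T g a)) -> F =1 G.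
Proof.
move=> Fc Gc FG; apply: (linear_eq_cspan Fc Gc (tens_dense T)).
by move=> _ /set_mem[g [a ->]].
Qed.

End TensorDensity.

(** * Hilbert spaces and faithful representations *)

Section HilbertNorm.
Context {R : realType} {H : hilbertType R}.
Implicit Types u v : H.

(** The Cauchy-Schwarz inequality, from the square of the norm of the component
    of u orthogonal to v. *)
Lemma inner_normr_le u v : `|inner u v| <= `|u| * `|v| :> R[i].
Proof.
have [->|v0] := eqVneq v 0; first by rewrite linear0r normr0 mulr_ge0.
have vp : 0 < `|v| ^+ 2 by rewrite exprn_gt0 // normr_gt0.
rewrite -(@ler_pXn2r _ 2%N)// ?nnegrE ?mulr_ge0// exprMn -ler_pdivrMr//.
have vJ : Num.conj (`|v| ^+ 2)^-1 = (`|v| ^+ 2)^-1.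
  by rewrite conj_Creal// realE invr_ge0 ltW.
have uv : inner v u = Num.conj (inner u v) by rewrite [LHS]hermC /= expr0 mul1r.
have := inner_ge0 (u - (inner u v / `|v| ^+ 2) *: v).
rewrite linearBl !linearBr /= !linearZl_LR !linearZr_LR/= -!normr_inner uv.
rewrite normCK rmorphM /= vJ.
set x := inner u v; set N := `|v| ^+ 2 in vp *.
have -> : `|u| ^+ 2 - x^* / N * x - (x / N * x^* - x / N * (x^* / N * N)) =
   `|u| ^+ 2 - x * x^* / N.
  by field; rewrite gt_eqF.
by rewrite subr_ge0.
Qed.

End HilbertNorm.

Section FaithfulRep.
Context {R : realType} {A : cstarAlgType R} {H : hilbertType R}.
Context (p : faithful_rep A H).
Implicit Types (x y u : A) (h k : H).

Lemma act_le x h : rnorm (p x h) <= rnorm x * rnorm h.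
Proof.
rewrite -lecR rmorphM/= -!rnormE.
exact: (act_norm p x (normr_ge0 x)).1.
Qed.

Lemma actN x h : p (- x) h = - p x h.
Proof. by rewrite -scaleN1r actZ scaleN1r. Qed.

Lemma act_inj x y : (forall h, p x h = p y h) -> x = y.
Proof.
move=> xy; apply/subr0_eq/normr0_eq0/eqP; rewrite eq_le normr_ge0 andbT.
apply/(act_norm p) => // h.
by rewrite actD actN xy subrr normr0 mul0r.
Qed.

(** A left unit need not act as the identity in general; it does so when the
    representation is cyclic. *)
Lemma unit_act_id u xi : (forall x, u ** x = x) ->
  closure [set h | exists x, h = p x xi] = setT -> forall h, p u h = h.
Proof.
move=> ul ST h.
have : closure [set h | exists x, h = p x xi] h by rewrite ST.
apply: (linear_eq_closure (F := p u) (G := idfun)).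
- exact: bounded_continuous (act_le u).
- by move=> x; exact: cvg_id.
by move=> _ /set_mem[x ->]; rewrite -actM ul.
Qed.

Section ActId.
Context (u : A) (u1 : forall h, p u h = h).

Lemma act_id_mull x : u ** x = x.
Proof. by apply: act_inj => h; rewrite actM u1. Qed.

Lemma act_id_mulr x : x ** u = x.
Proof. by apply: act_inj => h; rewrite actM u1. Qed.

Lemma act_id_adj : adj u = u.
Proof. by rewrite -[LHS]act_id_mulr -{2}[u]adjK -adjM act_id_mulr adjK. Qed.

End ActId.

Lemma inner_adjM x h : inner (p (adj x ** x) h) h = `|p x h| ^+ 2.
Proof. by rewrite actM act_adj -normr_inner. Qed.

(** The norm is monotone: x* x <= z* z as operators, since their difference y* y
    is positive. *)
Lemma rnorm_le_adjMD x y z :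
  adj z ** z = adj x ** x + adj y ** y -> rnorm x <= rnorm z.
Proof.
move=> zxy; rewrite -lecR -!rnormE; apply/(act_norm p) => // h.
apply: le_trans ((act_norm p z (normr_ge0 z)).1 (lexx _) h).
rewrite -(@ler_pXn2r _ 2%N)// ?nnegrE// -!inner_adjM zxy actD linearDl/=.
by rewrite lerDl inner_adjM exprn_ge0.
Qed.

End FaithfulRep.

(** * Slices of minimal tensor products *)

Section TensorUnit.
Context {R : realType} {C A : concreteCstar R} (T : min_tensor C A).
Context (u : C) (u1 : forall h, cc_rep C u h = h).

(** The unit u satisfies u - y* y = d* d with d = u - c.  Then
      (y (x) a)* (y (x) a) + (d (x) a)* (d (x) a) = (u (x) a)* (u (x) a),
    so the first summand is dominated by the right-hand side. *)
Let tens_le_of_lt1 y a :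
  rnorm y < 1 -> rnorm (tens T y a) <= rnorm (tens T u a).
Proof.
move=> y1; have uu := act_id_mull u1; have uA := act_id_adj u1.
have [||c cA cy] := @sqrt_one_sub _ C (adj y ** y).
- by rewrite adjM adjK.
- by rewrite rnorm_adjM expr_lt1 ?rnorm_ge0.
apply: (rnorm_le_adjMD (mt_rep T) (y := tens T (u - c) a)).
have dd : (u - c) ** (u - c) = u - (2 *: c - c ** c).
  rewrite amulDr amulNr (act_id_mulr u1) amulDl amulNl (act_id_mull u1).
  by rewrite scaler_nat mulr2n -[c + c - _]addrA [in RHS]opprD addrA.
rewrite !tens_adj !tensM uA uu adjD adjN uA cA dd cy linearBl/=.
by rewrite addrC subrK.
Qed.

(** Scaling y to norm less than 1.  The constant |u (x) a| in place of |a| is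
    what a square root taken inside the algebra gives; it suffices for the
    continuity of y |-> y (x) a. *)
Lemma tens_le_unit y a : rnorm (tens T y a) <= rnorm (tens T u a) * rnorm y.
Proof.
apply/ler_addgt0Pr => e e0.
set M := rnorm (tens T u a).
have M0 : 0 < M + 1 by rewrite ltr_wpDl ?rnorm_ge0.
(* y / r has norm < 1, and r M <= |y| M + e *)
pose r := rnorm y + e / (M + 1).
have r0 : 0 < r by rewrite ltr_wpDl ?rnorm_ge0 ?divr_gt0.
have rC : r%:C != 0 :> R[i] by rewrite gt_eqF ?ltcR.
have Re_r : complex.Re `|r%:C| = r by rewrite gtr0_norm ?ltcR.
rewrite -{1}[y](scalerKV rC) linearZl_LR/= rnormZ Re_r.
have : rnorm ((r%:C)^-1 *: y) < 1.
  rewrite rnormZ normfV gtr0_norm ?ltcR// -fmorphV/= mulrC ltr_pdivrMr// mul1r.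
  by rewrite ltrDl divr_gt0.
move=> /tens_le_of_lt1-/(_ a) /(ler_wpM2l (ltW r0)) /le_trans; apply.
rewrite -/M /r mulrC mulrDr lerD2l mulrA ler_pdivrMr// mulrC.
rewrite ler_wpM2l ?(ltW e0)//.
by rewrite lerDl.
Qed.

Lemma tens_continuous a : continuous (tens T ^~ a).
Proof.
exact: (@bounded_continuous _ _ _ (applyr (tens T) a) _ (tens_le_unit ^~ a)).
Qed.

End TensorUnit.

Section SliceMap.
Context {R : realType} {C A : concreteCstar R} (T : min_tensor C A).
Context (xi : cc_space C) (xi1 : `|xi| = 1 :> R[i]).

Local Notation xt := (ht_tens (mt_space T) xi).

(** a acts as the compression V* x V of x by the isometry V k = xi (x) k.  This
    is a relation because V* x V is only an operator: that it comes from an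
    element of A is [is_slice_ex]. *)
Definition is_slice (x : T) (a : A) : Prop := forall k k',
  inner (cc_rep A a k) k' = inner (mt_rep T x (xt k)) (xt k').

Lemma normr_xt k : `|xt k| = `|k| :> R[i].
Proof.
apply/eqP; rewrite -(@eqrXn2 _ 2%N)// !normr_inner inner_ht -normr_inner.
by rewrite xi1 expr1n mul1r.
Qed.

Lemma is_slice_lin (c : R[i]) x y a b :
  is_slice x a -> is_slice y b -> is_slice (c *: x + y) (c *: a + b).
Proof.
move=> xa yb k k'; rewrite !actD !actZ !linearDl/= !linearZl_LR/=.
by rewrite xa yb.
Qed.

Lemma is_slice_sub x y a b :
  is_slice x a -> is_slice y b -> is_slice (x - y) (a - b).
Proof.
move=> xa yb; rewrite -[x - y]addrC -[a - b]addrC -[- y]scaleN1r -[- b]scaleN1r.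
exact: is_slice_lin.
Qed.

(** |a k|^2 = <x (xi (x) k), xi (x) a k> <= |x| |k| |a k|. *)
Lemma is_slice_le x a : is_slice x a -> rnorm a <= rnorm x.
Proof.
move=> xa; rewrite -lecR -!rnormE; apply/(act_norm (cc_rep A)) => // k.
have [->|a0] := eqVneq (cc_rep A a k) 0; first by rewrite normr0 mulr_ge0.
have ap : 0 < `|cc_rep A a k| by rewrite normr_gt0.
rewrite -(ler_pM2r ap) -expr2 normr_inner xa.
apply: le_trans (real_ler_norm _) _.
  by rewrite -xa -normr_inner realE exprn_ge0.
apply: le_trans (inner_normr_le _ _) _.
rewrite normr_xt ler_pM2r// -(normr_xt k).
exact: (act_norm (mt_rep T) x (normr_ge0 x)).1.
Qed.

Lemma is_slice_inj x a b : is_slice x a -> is_slice x b -> a = b.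
Proof.
move=> xa xb; apply/subr0_eq/rnorm0_eq0/eqP; rewrite eq_le rnorm_ge0 andbT.
rewrite -(@rnorm0 _ (T : normedModType R[i])) -(subrr x).
exact: is_slice_le (is_slice_sub xa xb).
Qed.

Lemma is_slice_tens g a : is_slice (tens T g a) (inner (cc_rep C g xi) xi *: a).
Proof.
by move=> k k'; rewrite actZ linearZl_LR/= act_tens inner_ht.
Qed.

Lemma is_slice0 : is_slice 0 0.
Proof. by have := is_slice_tens 0 0; rewrite linear0r scaler0. Qed.

(** The compressions of a convergent sequence form a Cauchy sequence by
    [is_slice_le]; its limit in A is the compression of the limit, as matrix
    coefficients are continuous. *)
Lemma is_slice_closure x : closure [set y | exists a, is_slice y a] x ->
  exists a, is_slice x a.
Proof.
move=> clx.
have p0 n : 0 < 2^-1 ^+ n :> R by rewrite exprn_gt0// invr_gt0.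
have geo (e : R) : 0 < e -> exists N, 2^-1 ^+ N < e.
  move=> e0.
  have /cvgrPdist_lt/(_ _ e0) : (2^-1 : R) ^+ n @[n --> \oo] --> (0 : R).
    by apply: cvg_expr; rewrite ger0_norm ?invr_ge0// invf_lt1// ltr1n.
  move=> [N _ /(_ N (leqnn _))]; rewrite sub0r normrN ger0_norm ?(ltW (p0 _))//.
  by exists N.
have /choice[ya yaP] n : exists ya : T * A,
    is_slice ya.1 ya.2 /\ rnorm (x - ya.1) < 2^-1 ^+ n.
  by have [y [a ya] xy] := closure_approx clx (p0 n); exists (y, a).
pose y n := (ya n).1; pose a n := (ya n).2.
have xy n m : (n <= m)%N -> rnorm (x - y m) <= 2^-1 ^+ n.
  move=> nm; apply: le_trans (ltW (yaP m).2) _.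
  by rewrite ler_wiXn2l// ?invr_ge0// invf_le1// ler1n.
have ay n m : rnorm (a n - a m) <= rnorm (y n - y m).
  by apply/is_slice_le/is_slice_sub; apply: (yaP _).1.
have /cvg_ex[l /cvg_rnormP al] : cvg (a n @[n --> \oo]).
  apply: cauchy_seq_cvg => e e0; have [|N Ne] := geo (e / 2).
    by rewrite divr_gt0.
  exists N => n Nn; apply: le_lt_trans (ay _ _) _.
  have -> : y N - y n = (y N - x) + (x - y n) by rewrite addrA subrK.
  apply: le_lt_trans (rnormD _ _) _.
  rewrite [ltRHS]splitr [rnorm (y N - x)]rnormB ltrD//;
    exact: le_lt_trans (xy N _ _) Ne.
exists l => k k'; apply/subr0_eq/normr0_eq0/eqP.
rewrite eq_le normr_ge0 andbT; apply/ler_addgt0Pl => e e0; rewrite addr0.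
(* the + 1 keeps M positive when k or k' vanishes *)
set M := `|k| * `|k'| + 1 : R[i].
have M0 : 0 < M by rewrite ltr_wpDl// mulr_ge0.
have /Re_gt0[d0 dE] : 0 < e / 2 / M by rewrite !divr_gt0.
set d := complex.Re _ in d0 dE.
have [n [ln xn]] : exists n, rnorm (l - a n) < d /\ rnorm (x - y n) < d.
  have [N1 _ N1P] := al _ d0; have [N2 N2d] := geo _ d0.
  exists (maxn N1 N2); split; first by apply: N1P => /=; rewrite leq_maxl.
  by apply: le_lt_trans N2d; apply: xy; rewrite leq_maxr.
have bound (D : concreteCstar R) (z : D) h h' : rnorm z < d ->
    `|h| * `|h'| = `|k| * `|k'| :> R[i] -> `|inner (cc_rep D z h) h'| <= e / 2.
  move=> zd hk; apply: le_trans (inner_normr_le _ _) _.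
  have zh : `|cc_rep D z h| <= d%:C * `|h|.
    by move: h {hk}; apply/act_norm; rewrite ?lecR ?(ltW d0)// -rnorm_le ltW.
  apply: le_trans (ler_wpM2r (normr_ge0 _) zh) _.
  rewrite -mulrA hk -dE mulrAC ler_pdivrMr// ler_wpM2l ?lerDl//.
  by rewrite divr_ge0// ltW.
have -> : inner (cc_rep A l k) k' - inner (mt_rep T x (xt k)) (xt k') =
    inner (cc_rep A (l - a n) k) k' - inner (mt_rep T (x - y n) (xt k)) (xt k').
  rewrite -[l - _]addrC -[x - _]addrC -[- a n]scaleN1r -[- y n]scaleN1r.
  rewrite !actD !actZ !linearDl/= !linearZl_LR/= (yaP n).1.
  by rewrite opprD addrACA !mulN1r opprK addNr add0r.
apply: le_trans (ler_normB _ _) _; rewrite [leRHS]splitr lerD//.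
  exact: bound.
by apply: (bound T) => //; rewrite !normr_xt.
Qed.

Lemma is_slice_ex x : exists a, is_slice x a.
Proof.
apply: is_slice_closure.
have : cspan [set x | exists a b, x = tens T a b] x by rewrite tens_dense.
apply: closureS => _ [n [c [v [vT ->]]]].
elim/big_ind : _ => [|y z [a ya] [b zb]|i _].
- by exists 0; exact: is_slice0.
- by exists (a + b); rewrite -[y]scale1r -[a]scale1r; exact: is_slice_lin.
have [g [a ->]] := vT i.
exists (c i *: (inner (cc_rep C g xi) xi *: a) + 0).
rewrite -[c i *: _]addr0.
by apply: is_slice_lin; [exact: is_slice_tens|exact: is_slice0].
Qed.

Definition slice (x : T) : A := projT1 (cid (is_slice_ex x)).

Lemma sliceP x : is_slice x (slice x).
Proof. exact: projT2 (cid (is_slice_ex x)). Qed.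

Let slice_linear : linear slice.
Proof.
move=> c x y; apply: is_slice_inj (sliceP _) _.
by apply: is_slice_lin; exact: sliceP.
Qed.
HB.instance Definition _ := GRing.isLinear.Build R[i] T A _ slice slice_linear.

Lemma slice_tens g a : slice (tens T g a) = inner (cc_rep C g xi) xi *: a.
Proof. exact: is_slice_inj (sliceP _) (is_slice_tens _ _). Qed.

Lemma slice_le x : rnorm (slice x) <= rnorm x.
Proof. exact: is_slice_le (sliceP x). Qed.

End SliceMap.

(** * The conditional expectation onto the fixed point algebra *)

Section ConditionalExpectation.
Context {R : realType} {G : compact_quantum_group R}.

Lemma cqg_one_act h : cc_rep G (cqg_one G) h = h.
Proof. exact: unit_act_id (@cqg_mul1l _ G) (cqg_vec_cyclic G) h. Qed.

Lemma cqg_one_tens_act h :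
  mt_rep (cqg_tens G) (tens (cqg_tens G) (cqg_one G) (cqg_one G)) h = h.
Proof.
apply: (linear_eq_cspan (F := mt_rep _ _) (G := idfun) _ _
  (ht_dense (mt_space (cqg_tens G)))).
- exact: bounded_continuous (act_le _ _).
- by move=> x; exact: cvg_id.
by move=> _ /set_mem[k [l ->]]; rewrite act_tens !cqg_one_act.
Qed.

Lemma haar_one : haar (cqg_one G) = 1.
Proof. by rewrite /haar cqg_one_act -normr_inner cqg_vec_norm expr1n. Qed.

Definition haar_slice (A : concreteCstar R) (T : min_tensor G A) :
  {linear T -> A} := slice (cqg_vec_norm G).

Lemma haar_slice_tens (A : concreteCstar R) (T : min_tensor G A) g a :
  haar_slice T (tens T g a) = haar g *: a.
Proof. exact: slice_tens. Qed.

Lemma haar_slice_le (A : concreteCstar R) (T : min_tensor G A) x :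
  rnorm (haar_slice T x) <= rnorm x.
Proof. exact: slice_le. Qed.

Lemma haar_slice_continuous (A : concreteCstar R) (T : min_tensor G A) :
  continuous (haar_slice T).
Proof.
apply: (@bounded_continuous _ _ _ _ 1) => x.
by rewrite mul1r haar_slice_le.
Qed.

Lemma star_hom_le (A B : concreteCstar R) (f : {linear A -> B}) x :
  star_hom f -> rnorm (f x) <= rnorm x.
Proof.
by move=> fs; rewrite -lecR -!rnormE; exact: (star_hom_norm (cc_rep B)).
Qed.

Lemma star_hom_continuous (A B : concreteCstar R) (f : {linear A -> B}) :
  star_hom f -> continuous f.
Proof.
move=> fs; apply: (@bounded_continuous _ _ _ _ 1) => x.
by rewrite mul1r star_hom_le.
Qed.

Context (A : G_cstar G).

Lemma coact_le a : rnorm (coact A a) <= rnorm a.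
Proof. exact: (@star_hom_le A (gc_tens A) _ _ (coact_hom A)). Qed.

Lemma one_tens_le a : rnorm (tens (gc_tens A) (cqg_one G) a) <= rnorm a.
Proof. exact: (@star_hom_le A (gc_tens A) _ _ (@one_tens_hom _ G A)). Qed.

Definition average (a : A) : A := haar_slice (gc_tens A) (coact A a).

(** Slicing the first leg of (id (x) alpha) alpha a = (Delta (x) id) alpha a by
    the Haar state gives alpha (E a) on the left-hand side, and on the
    right-hand side 1 (x) E a, by left invariance. *)
Lemma average_fixed a : average a \in fixed A.
Proof.
have [CC_A [C_CA [Delta_id [id_alpha [assoc
  [[Dc DT] [ic iT] ac aT coassoc]]]]]] := coactP A.
have [Sl [[Slc SlT] SlD]] := haar_invl G.
pose S := haar_slice C_CA.
have Sc : continuous S := haar_slice_continuous (T := C_CA).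
have cA : continuous (coact A) := star_hom_continuous (coact_hom A).
have c1 : continuous (tens (gc_tens A) (cqg_one G)).
  exact: (@star_hom_continuous A (gc_tens A) _ (@one_tens_hom _ G A)).
have Sid : S \o id_alpha =1 coact A \o haar_slice (gc_tens A).
  apply: tensor_ext => [x|x|g b].
  - by apply: continuous_comp; [exact: ic|exact: Sc].
  - by apply: continuous_comp; [exact: haar_slice_continuous|exact: cA].
  by rewrite /= iT !haar_slice_tens linearZ.
(* (h (x) id (x) id) (y (x) b) = (h (x) id) y (x) b for every y, in particular
   for y = Delta g *)
have Sassoc b : S \o assoc \o applyr (tens CC_A) b =1
    applyr (tens (gc_tens A)) b \o Sl.
  apply: tensor_ext => [x|x|g h].
  - apply: continuous_comp; last first.
      by apply: continuous_comp; [exact: ac|exact: Sc].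
    exact: (@tens_continuous _ (cqg_tens G) A CC_A _ cqg_one_tens_act b).
  - apply: continuous_comp; first exact: Slc.
    exact: (tens_continuous (T := gc_tens A) cqg_one_act).
  by rewrite /= aT haar_slice_tens SlT linearZl_LR.
have SD : S \o assoc \o Delta_id =1
    tens (gc_tens A) (cqg_one G) \o haar_slice (gc_tens A).
  apply: tensor_ext => [x|x|g b].
  - apply: continuous_comp; first exact: Dc.
    by apply: continuous_comp; [exact: ac|exact: Sc].
  - by apply: continuous_comp; [exact: haar_slice_continuous|exact: c1].
  rewrite /= DT haar_slice_tens linearZ/=.
  by have /= -> := Sassoc b (comul G g); rewrite SlD linearZl_LR.
apply/fixedP; have /= <- := Sid (coact A a).
by rewrite -coassoc; exact: SD.
Qed.

Definition expectation (a : A) : fixalg A := Fixalg (average_fixed a).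

Lemma average_le a : rnorm (average a) <= rnorm a.
Proof. exact: le_trans (haar_slice_le _) (coact_le a). Qed.

Lemma average_dist a :
  rnorm (average a - a) <= rnorm (coact A a - tens (gc_tens A) (cqg_one G) a).
Proof.
have -> : average a - a =
    haar_slice (gc_tens A) (coact A a - tens (gc_tens A) (cqg_one G) a).
  by rewrite linearB haar_slice_tens haar_one scale1r.
exact: haar_slice_le.
Qed.

End ConditionalExpectation.

(** * Lifting fixed elements of the sequence algebra *)

Section SequenceLifting.
Context {R : realType} {G : compact_quantum_group R} {A : G_cstar G}.

Lemma bounded_fix_val (u : linfty (fixalg A)) :
  (fun n => fix_val (u n)) \in @bounded_seq R A.
Proof. by have [M [_ uM]] := linftyP u; apply/bounded_seqP; exists M. Qed.

Definition linfty_fix_val (u : linfty (fixalg A)) : linfty A :=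
  Linfty (bounded_fix_val u).

(** (A^alpha)_oo embeds in A_oo, so identities between classes of fixed
    sequences can be checked in A_oo. *)
Lemma cls_fix_val_inj (u v : linfty (fixalg A)) :
  cls (linfty_fix_val u) = cls (linfty_fix_val v) -> cls u = cls v.
Proof. by move=> /clsP uv; apply/clsP => e /uv. Qed.

Lemma seq_map_bounded (B : cstarAlgType R) (f : {linear A -> B}) x :
  (forall a, rnorm (f a) <= rnorm a) -> exists2 v : linfty B,
    (forall n, v n = f (rep x n)) & seq_map f x = cls v.
Proof.
move=> f1; have [M [_ uM]] := linftyP (rep x).
have fb : (fun n => f (rep x n)) \in @bounded_seq R B.
  by apply/bounded_seqP; exists M => n; exact: le_trans (f1 _) (uM n).
by exists (Linfty fb) => //; rewrite /seq_map -seq_classE.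
Qed.

Lemma bounded_expectation (u : linfty A) :
  (fun n => expectation (u n)) \in @bounded_seq R (fixalg A).
Proof.
have [M [_ uM]] := linftyP u; apply/bounded_seqP; exists M => n.
exact: le_trans (average_le (u n)) (uM n).
Qed.

Definition linfty_expectation (u : linfty A) : linfty (fixalg A) :=
  Linfty (bounded_expectation u).

(** The hypothesis says that alpha a_n - 1 (x) a_n -> 0 for a representing
    sequence (a_n) of x, and this dominates E a_n - a_n. *)
Lemma cls_expectation (x : seqalg A) :
  seq_map (coact A) x = seq_map (tens (gc_tens A) (cqg_one G)) x ->
  cls (linfty_fix_val (linfty_expectation (rep x))) = x.
Proof.
have [v vE ->] := seq_map_bounded x (@coact_le _ _ A).
have [w wE ->] := seq_map_bounded x (@one_tens_le _ _ A).
move=> /clsP vw; rewrite -[RHS]repK; apply/clsP => e /vw.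
apply: filterS => n; rewrite vE wE; apply: le_lt_trans.
exact: average_dist.
Qed.

End SequenceLifting.

Section FixedLift.
Context {R : realType} {G : compact_quantum_group R} {A : G_cstar G}.
Context {D : cstarAlgType R} (psi : {linear D -> seqalg A}).
Context (psi_fixed : forall d,
  seq_map (coact A) (psi d) = seq_map (tens (gc_tens A) (cqg_one G)) (psi d)).

Definition fixed_lift (d : D) : seqalg (fixalg A) :=
  cls (linfty_expectation (rep (psi d))).

(** Uniqueness of the lift: any fixed sequence that represents psi d gives it.
    The algebraic identities below follow by exhibiting such a sequence. *)
Lemma fixed_lift_eq d (u : linfty (fixalg A)) :
  cls (linfty_fix_val u) = psi d -> fixed_lift d = cls u.
Proof. by move=> ud; apply: cls_fix_val_inj; rewrite cls_expectation. Qed.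

Lemma fixed_liftP d :
  exists2 u, fixed_lift d = cls u & cls (linfty_fix_val u) = psi d.
Proof.
by exists (linfty_expectation (rep (psi d))); last exact: cls_expectation.
Qed.

Let fixed_lift_linear : linear fixed_lift.
Proof.
move=> c x y; have [u -> ux] := fixed_liftP x; have [v -> vy] := fixed_liftP y.
rewrite -clsZ' -clsD; apply: fixed_lift_eq.
rewrite linearP -ux -vy -clsZ' -clsD.
by congr cls; exact: linfty_ext.
Qed.
HB.instance Definition _ :=
  GRing.isLinear.Build R[i] D (seqalg (fixalg A)) _
    fixed_lift fixed_lift_linear.

Definition fixed_lift_map : {linear D -> seqalg (fixalg A)} := fixed_lift.

Lemma fixed_lift_hom : star_hom psi -> star_hom fixed_lift_map.
Proof.
move=> [psiM psiA]; split=> [x y|x]; have [u xu ux] := fixed_liftP x.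
  have [v yv vy] := fixed_liftP y.
  rewrite -[RHS]/(fixed_lift x ** fixed_lift y) xu yv -[RHS]clsM.
  apply: fixed_lift_eq.
  by rewrite psiM -ux -vy -[RHS]clsM; congr cls; exact: linfty_ext.
rewrite -[RHS]/(adj (fixed_lift x)) xu -[RHS]clsA; apply: fixed_lift_eq.
by rewrite psiA -ux -[RHS]clsA; congr cls; exact: linfty_ext.
Qed.

End FixedLift.

(** Equivariance gives alpha_oo (psi b) = (id (x) psi) (beta b), and the
    right-hand side is 1 (x) psi b since beta b = 1 (x) b. *)
Lemma seq_equivariant_fixed (R : realType) (G : compact_quantum_group R)
    (A B : G_cstar G) (psi : {linear B -> seqalg A}) (b : B) :
  seq_equivariant psi -> b \in fixed B ->
  seq_map (coact A) (psi b) = seq_map (tens (gc_tens A) (cqg_one G)) (psi b).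
Proof.
move=> [_ [H [rho [CAoo [id_psi [incl [[_ idT] [_ inclT] ->]]]]]]] /fixedP ->.
by rewrite idT inclT.
Qed.

Section ConstantSequences.
Context {R : realType} {D : cstarAlgType R}.

Lemma bounded_const (d : D) : (fun=> d) \in @bounded_seq R D.
Proof. by apply/bounded_seqP; exists (rnorm d). Qed.

Lemma seq_constE (d : D) :
  seq_const d = cls (Linfty (bounded_const d)).
Proof. by rewrite -seq_classE. Qed.

End ConstantSequences.

Theorem proposition3p6 (R : realType) (G : compact_quantum_group R)
    (hG : coexact G) (A B : G_cstar G) (phi : {linear A -> B})
    (phi_eq : equivariant phi) (phi_split : eq_seq_split phi) :
  seq_split (fix_map phi_eq).
Proof.
have [[phiM phiA] _] := phi_eq.
split; first by split=> [x y|x]; apply/val_inj; [exact: phiM|exact: phiA].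
have [_ [psi [psi_eq psi_phi]]] := phi_split.
pose psi0 : {linear fixalg B -> seqalg A} := psi \o val.
have psi0_fixed b : seq_map (coact A) (psi0 b) =
    seq_map (tens (gc_tens A) (cqg_one G)) (psi0 b).
  exact: seq_equivariant_fixed psi_eq (fix_valP b).
exists (fixed_lift_map psi0_fixed); split.
  have [[psiM psiA] _] := psi_eq.
  by apply: fixed_lift_hom; split=> [x y|x]; [exact: psiM|exact: psiA].
move=> a; rewrite seq_constE; apply: (fixed_lift_eq psi0_fixed).
rewrite -[RHS]/(psi (phi (fix_val a))) psi_phi seq_constE.
by congr cls; exact: linfty_ext.
Qed.
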